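(* The manifold $M^{16}=S^{15}\times S^1=(Spin(9)/Spin_\Delta(7))\times S^1$, with the product of the round metric on $S^{15}$ and the standard metric on $S^1$, admits a homogeneous (i.e. $Spin(9)\times S^1$-invariant) nearly parallel $Spin(9)$-structure whose associated vector field $\Gamma$ is not zero.
   Context: $Spin(9)\subset SO(16)$: $\mathbb R^{16}=\Delta_9$ is the real spin representation. It carries nine symmetric involutions $I_1,\dots,I_9$ with $I_\alpha^2=\mathrm{Id}$, $I_\alpha^*=I_\alpha$, $I_\alpha I_\beta=-I_\beta I_\alpha$ ($\alpha\ne\beta$), spanning a copy of $\mathbb R^9$ in the symmetric endomorphisms, and $Spin(9)$ is the group of all products of an even number of unit vectors of this $\mathbb R^9$. It acts transitively on the unit sphere $S^{15}\subset\Delta_9$, and $Spin_\Delta(7)$ (isomorphic to $Spin(7)$) denotes the isotropy group of a point. The Lie algebra of $Spin(9)$ is $\mathfrak{spin}(9)=\mathrm{Lin}(I_\alpha I_\beta:\alpha<\beta)$ and its orthogonal complement in $\mathfrak{so}(16)$ is $\mathfrak m=\mathrm{Lin}(I_\alpha I_\beta I_\gamma:\alpha<\beta<\gamma)$, where $\mathrm{Lin}$ denotes the real linear span. A $Spin(9)$-structure on an oriented Riemannian manifold $(M^{16},g)$ is a reduction $\mathcal R$ of the $SO(16)$-frame bundle to $Spin(9)$; locally it gives sections $I_1,\dots,I_9$ of $\mathrm{End}(TM^{16})$ with $I_\alpha^2=\mathrm{Id}$, $I_\alpha^*=I_\alpha$, $I_\alpha I_\beta=-I_\beta I_\alpha$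 ($\alpha\ne\beta$). Restrict the Levi-Civita connection form $Z$ to $\mathcal R$ and decompose $Z|_{\mathcal R}=Z^*\oplus\Gamma$ according to $\mathfrak{so}(16)=\mathfrak{spin}(9)\oplus\mathfrak m$; then $\Gamma$ is a 1-form on $M^{16}$ with values in $\mathcal R\times_{Spin(9)}\mathfrak m\subset\mathrm{End}(TM^{16})$. The structure is nearly parallel if $\Gamma$ is a vector field, i.e. there is a vector field, also denoted $\Gamma$, such that the 1-form is $X\mapsto 6\sum_{\alpha<\beta<\gamma} g(I_\gamma I_\beta I_\alpha\Gamma, X)\, I_\alpha I_\beta I_\gamma$. *)

(* Defs.v *)
From HB Require Import structures.
From mathcomp Require Import all_boot all_order all_algebra.
From mathcomp Require Import all_classical all_reals all_analysis.

Set Implicit Arguments.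
Unset Strict Implicit.
Unset Printing Implicit Defensive.

Import Order.TTheory GRing.Theory Num.Theory.
Import numFieldNormedType.Exports.

Local Open Scope classical_set_scope.
Local Open Scope ring_scope.

(** [ambient R] is [R^18 = R^16 x R^2], with components [usubmx p], [dsubmx p]. *)
Notation ambient R := 'cV[R]_(16 + 2).
Notation connection_operator R :=
  (ambient R -> ambient R -> (ambient R -> ambient R) -> ambient R).

Definition dot (R : realType) (n : nat) (u v : 'cV[R]_n) : R :=
  (u^T *m v) ord0 ord0.

(** ** The group Spin(9) and the splitting of so(16) *)

(** Matrices act on column vectors, so [A *m B] is the composition "B first". *)
Definition clifford9 (R : realType) (I : 'I_9 -> 'M[R]_16) : Prop :=
  [/\ forall a, I a *m I a = 1%:M,
      forall a, (I a)^T = I a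
    & forall a b, a != b -> I a *m I b = - (I b *m I a)].

(** Such nine involutions exist: products of Pauli matrices on [(R^2)^{(x) 4}],
    written as signed permutation matrices acting on 4-bit indices. *)
Section clifford9_exists.

Let xs : seq nat := [:: 0; 1; 3; 5; 7; 9; 11; 13; 15]%N.
Let zs : seq nat := [:: 1; 0; 3; 7; 13; 15; 9; 11; 5]%N.
Let f (a i : nat) : nat := Nat.lxor (nth 0%N xs a) i.
Let s (a i : nat) : bool :=
  let k := Nat.land (nth 0%N zs a) i in
  Nat.testbit k 0 (+) Nat.testbit k 1 (+) Nat.testbit k 2 (+) Nat.testbit k 3.

Let I (R : realType) (a : 'I_9) : 'M[R]_16 :=
  \matrix_(i, j) ((j == f a i :> nat)%:R * (-1) ^+ s a i).

Let all_iota n (P : pred nat) (i : 'I_n) : all P (iota 0 n) -> P i.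
Proof. by move/allP; apply; rewrite mem_iota ltn_ord. Qed.

Let f_lt (a : 'I_9) (i : 'I_16) : (f a i < 16)%N.
Proof.
have H : all (fun a => all (fun i => f a i < 16)%N (iota 0 16)) (iota 0 9).
  by vm_compute.
exact: all_iota i (all_iota a H).
Qed.

Let mulI (R : realType) (a b : 'I_9) (i j : 'I_16) :
  (I R a *m I R b) i j =
  (j == f b (f a i) :> nat)%:R * (-1) ^+ (s a i (+) s b (f a i)).
Proof.
rewrite mxE (bigD1 (Ordinal (f_lt a i))) //= !mxE /= eqxx mul1r.
rewrite big1 ?addr0 => [|k ki]; first by rewrite signr_addb mulrCA.
by rewrite !mxE -[_ == _ :> nat]/(k == Ordinal (f_lt a i)) (negbTE ki) !mul0r.
Qed.

Lemma clifford9_exists (R : realType) :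
  exists J : 'I_9 -> 'M[R]_16, clifford9 J.
Proof.
exists (I R); split => [a|a|a b ab].
- apply/matrixP => i j; rewrite mulI mxE.
  have H : all (fun a => all (fun i =>
    (f a (f a i) == i) && (s a (f a i) == s a i)) (iota 0 16)) (iota 0 9).
    by vm_compute.
  move: (all_iota i (all_iota a H)) => /andP[/eqP -> /eqP ->].
  by rewrite addbb mulr1 eq_sym.
- apply/matrixP => i j; rewrite !mxE.
  have H : all (fun a => all (fun i => all (fun j =>
    (((i == f a j) == (j == f a i)) && ((j == f a i) ==> (s a j == s a i))))
     (iota 0 16)) (iota 0 16)) (iota 0 9).
    by vm_compute.
  move: (all_iota j (all_iota i (all_iota a H))) => /andP[/eqP ->].
  by case: eqP => [_ /eqP -> //|_ _]; rewrite !mul0r.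
- apply/matrixP => i j; rewrite [RHS]mxE !mulI.
  have H : all (fun a => all (fun b => (a != b) ==> all (fun i =>
    (f a (f b i) == f b (f a i)) &&
    (s b i (+) s a (f b i) == ~~ (s a i (+) s b (f a i))))
     (iota 0 16)) (iota 0 9)) (iota 0 9).
    by vm_compute.
  move: (all_iota b (all_iota a H)) => /implyP/(_ ab) Hab.
  move: (all_iota i Hab) => /andP[/eqP -> /eqP ->].
  by rewrite signrN mulrN opprK.
Qed.

End clifford9_exists.

Definition unit9 (R : realType) (I : 'I_9 -> 'M[R]_16) : set 'M[R]_16 :=
  [set u | exists2 c : 'cV[R]_9, dot c c = 1 &
           u = \sum_(a < 9) c a ord0 *: I a].

Definition Spin9 (R : realType) (I : 'I_9 -> 'M[R]_16) : set 'M[R]_16 :=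
  [set g | exists s : seq 'M[R]_16,
     [/\ ~~ odd (size s), forall u, u \in s -> unit9 I u
       & g = \prod_(u <- s) u]].

Definition spinDelta7 (R : realType) (I : 'I_9 -> 'M[R]_16) (x : 'cV[R]_16) :
    set 'M[R]_16 :=
  [set g | Spin9 I g /\ g *m x = x].

(** [S^15 = Spin(9) / Spin_Delta(7)]: at every point [x] of the sphere, the
    orbit map [g |-> g x] goes onto the sphere and its fibres are the left
    cosets of the isotropy group of [x]. *)
Definition sphere_eq_quotient (R : realType) (I : 'I_9 -> 'M[R]_16) : Prop :=
  forall x : 'cV[R]_16, dot x x = 1 ->
  [/\ forall g, Spin9 I g -> dot (g *m x) (g *m x) = 1,
      forall y : 'cV[R]_16, dot y y = 1 -> exists2 g, Spin9 I g & g *m x = y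
    & forall g h, Spin9 I g -> Spin9 I h ->
        (g *m x = h *m x <-> exists2 k, spinDelta7 I x k & h = g *m k)].

Definition spin9_algebra (R : realType) (I : 'I_9 -> 'M[R]_16) :
    {vspace 'M[R]_16} :=
  (\sum_(a < 9) \sum_(b < 9 | (a < b)%N) <[I a *m I b]>)%VS.

Definition m_space (R : realType) (I : 'I_9 -> 'M[R]_16) :
    {vspace 'M[R]_16} :=
  (\sum_(a < 9) \sum_(b < 9 | (a < b)%N) \sum_(c < 9 | (b < c)%N)
     <[I a *m I b *m I c]>)%VS.

(** The component in [m] of an element of [so(16) = spin(9) (+) m]. *)
Definition m_part (R : realType) (I : 'I_9 -> 'M[R]_16) (A : 'M[R]_16) :
    'M[R]_16 :=
  daddv_pi (m_space I) (spin9_algebra I) A.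

(** ** The Riemannian manifold S^15 x S^1

    It is the submanifold [|x| = |z| = 1] of [R^16 x R^2]; the product of the
    round metric and the standard metric is the restriction of [dot] to its
    tangent spaces. *)

Definition M (R : realType) : set (ambient R) :=
  [set p | dot (usubmx p) (usubmx p) = 1 /\ dot (dsubmx p) (dsubmx p) = 1].

Definition TM (R : realType) (p : ambient R) : set (ambient R) :=
  [set v | dot (usubmx p) (usubmx v) = 0 /\ dot (dsubmx p) (dsubmx v) = 0].

(** C^n regularity on an open set, by iterated directional derivatives. *)
Fixpoint Cn (R : realType) (V W : normedModType R) (n : nat) (U : set V)
    (f : V -> W) : Prop :=
  (forall x, U x -> {for x, continuous f}) /\
  (if n is k.+1 then
     forall v, (forall x, U x -> derivable f x v) /\
               Cn k U (fun x => 'D_v f x)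
   else True).

(** Smoothness near [p] of a map defined on the submanifold: existence of a
    smooth local extension. Values of [f] outside [M] play no role. *)
Definition smooth_at (R : realType) (W : normedModType R)
    (p : ambient R) (f : ambient R -> W) : Prop :=
  exists (F : ambient R -> W) (U : set (ambient R)),
    [/\ open U, U p, forall n, Cn n U F
      & forall q, U q -> M q -> f q = F q].

Definition radial_proj (R : realType) (p : ambient R) : ambient R :=
  col_mx ((Num.sqrt (dot (usubmx p) (usubmx p)))^-1 *: usubmx p)
         ((Num.sqrt (dot (dsubmx p) (dsubmx p)))^-1 *: dsubmx p).

(** Derivative at [p] along a tangent vector [v] of a map defined on [M];
    the map is extended to a neighbourhood of [M] by the smooth retraction
    [radial_proj], so the result only depends on the values on [M]. *)
Definition dM (R : realType) (W : normedModType R) (p v : ambient R)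
    (f : ambient R -> W) : W :=
  'D_v (f \o @radial_proj R) p.

Definition vector_field_at (R : realType) (p : ambient R)
    (Y : ambient R -> ambient R) : Prop :=
  smooth_at p Y /\ (\forall q \near p, M q -> TM q (Y q)).

(** [[X, Y]^i = X(Y^i) - Y(X^i)] for the Cartesian components in [R^18]. *)
Definition lie_bracket (R : realType)
    (X Y : ambient R -> ambient R) (p : ambient R) : ambient R :=
  dM p (X p) Y - dM p (Y p) X.

(** [nabla p v Y] is the covariant derivative at [p] of the vector field [Y],
    defined near [p], in the direction of the tangent vector [v]. *)
Record affine_connection (R : realType) (nabla : connection_operator R) :
    Prop := AffineConnection {
  nabla_tangent : forall p v Y, M p -> TM p v -> vector_field_at p Y ->
    TM p (nabla p v Y);
  nabla_linear : forall p (a : R) v w Y,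
    M p -> TM p v -> TM p w -> vector_field_at p Y ->
    nabla p (a *: v + w) Y = a *: nabla p v Y + nabla p w Y;
  nabla_add : forall p v Y Y',
    M p -> TM p v -> vector_field_at p Y -> vector_field_at p Y' ->
    nabla p v (fun q => Y q + Y' q) = nabla p v Y + nabla p v Y';
  nabla_leibniz : forall p v (f : ambient R -> R) Y,
    M p -> TM p v -> smooth_at p (f : _ -> R^o) -> vector_field_at p Y ->
    nabla p v (fun q => f q *: Y q) =
      dM p v (f : _ -> R^o) *: Y p + f p *: nabla p v Y;
  nabla_smooth : forall p X Y,
    M p -> vector_field_at p X -> vector_field_at p Y ->
    smooth_at p (fun q => nabla q (X q) Y)
}.

Definition metric_connection (R : realType) (nabla : connection_operator R) :
    Prop :=
  forall p v Y Z,
    M p -> TM p v -> vector_field_at p Y -> vector_field_at p Z ->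
    dM p v ((fun q => dot (Y q) (Z q)) : _ -> R^o) =
      dot (nabla p v Y) (Z p) + dot (Y p) (nabla p v Z).

Definition torsion_free (R : realType) (nabla : connection_operator R) :
    Prop :=
  forall p X Y, M p -> vector_field_at p X -> vector_field_at p Y ->
    nabla p (X p) Y - nabla p (Y p) X = lie_bracket X Y p.

Definition levi_civita (R : realType) (nabla : connection_operator R) :
    Prop :=
  [/\ affine_connection nabla, metric_connection nabla & torsion_free nabla].

(** ** Spin(9)-structures on S^15 x S^1 *)

(** The fibre at [p] of the SO(16)-frame bundle. A frame is the matrix whose
    columns are its vectors, i.e. a linear isometry from [R^16] onto the tangent
    space. The orientation is the product of the boundary orientations (outward
    normal first): a frame [(v_1, .., v_15, w)] with [v_i] tangent to S^15 and
    [w] tangent to S^1 is positive iff [det(x, v_1, .., v_15)] and [det(z, w)]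
    have the same sign. *)
Definition SO_frame (R : realType) (p : ambient R) :
    set 'M[R]_(16 + 2, 16) :=
  [set e | [/\ forall j, TM p (col j e),
               e^T *m e = 1%:M
             & 0 < \det (row_mx e (row_mx (col_mx 0 (dsubmx p))
                                          (col_mx (usubmx p) 0))
                         : 'M[R]_(16 + 2))]].

Definition local_section (R : realType)
    (Q : ambient R -> set 'M[R]_(16 + 2, 16)) (p : ambient R)
    (s : ambient R -> 'M[R]_(16 + 2, 16)) : Prop :=
  smooth_at p s /\ (\forall q \near p, M q -> Q q (s q)).

(** A reduction [Q] of the frame bundle to Spin(9); [Q p] is its fibre at [p]. *)
Record spin9_structure (R : realType) (I : 'I_9 -> 'M[R]_16)
    (Q : ambient R -> set 'M[R]_(16 + 2, 16)) : Prop :=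
    Spin9Structure {
  reduction_frame : forall p, M p -> Q p `<=` SO_frame p;
  reduction_torsor : forall p e e', M p -> Q p e ->
    (Q p e' <-> exists2 g, Spin9 I g & e' = e *m g);
  reduction_section : forall p, M p -> exists s, local_section Q p s
}.

(** The group S^1 acts on the circle by rotations. *)
Definition SO2 (R : realType) : set 'M[R]_2 :=
  [set r | r^T *m r = 1%:M /\ \det r = 1].

(** Invariance of the reduction under [Spin(9) x S^1], acting by [(x, z) |-> (g x, r z)]; this
    action is the restriction of a linear map, which is thus its own
    differential. *)
Definition homogeneous_structure (R : realType) (I : 'I_9 -> 'M[R]_16)
    (Q : ambient R -> set 'M[R]_(16 + 2, 16)) : Prop :=
  forall g r p e, Spin9 I g -> SO2 r -> M p -> Q p e ->
    Q (block_mx g 0 0 r *m p) (block_mx g 0 0 r *m e).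

(** Pull-back of the connection form by a local section [s = (s_1, .., s_16)]:
    [nabla_v s_j = \sum_i Z_ij s_i]. *)
Definition connection_form (R : realType)
    (nabla : connection_operator R)
    (s : ambient R -> 'M[R]_(16 + 2, 16)) (p v : ambient R) :
    'M[R]_16 :=
  \matrix_(i, j) dot (col i (s p)) (nabla p v (fun q => col j (s q))).

(** Endomorphism of the tangent space with matrix [A] in the frame [e],
    extended by zero on the normal space. *)
Definition frame_end (R : realType) (e : 'M[R]_(16 + 2, 16)) (A : 'M[R]_16) :
    'M[R]_(16 + 2) :=
  e *m A *m e^T.

(** [X |-> 6 \sum_(a < b < c) g(I_c I_b I_a G, X) I_a I_b I_c], for a tangent
    vector [G] and the operators [I_a] on the tangent space given by [e]. *)
Definition vector_form (R : realType) (I : 'I_9 -> 'M[R]_16)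
    (e : 'M[R]_(16 + 2, 16)) (G X : ambient R) : 'M[R]_(16 + 2) :=
  let J a := frame_end e (I a) in
  6%:R *: \sum_(a < 9) \sum_(b < 9 | (a < b)%N) \sum_(c < 9 | (b < c)%N)
    dot (J c *m J b *m J a *m G) X *: (J a *m J b *m J c).

(** The structure [Q] is nearly parallel with associated vector field [G]. *)
Definition nearly_parallel (R : realType) (I : 'I_9 -> 'M[R]_16)
    (nabla : connection_operator R)
    (Q : ambient R -> set 'M[R]_(16 + 2, 16))
    (G : ambient R -> ambient R) : Prop :=
  (forall p, M p -> vector_field_at p G) /\
  (forall p s X, M p -> local_section Q p s -> TM p X ->
     frame_end (s p) (m_part I (connection_form nabla s p X)) =
     vector_form I (s p) (G p) X).

(* Main.v *)
From HB Require Import structures.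
Require Import Defs.
From mathcomp Require Import all_boot all_order all_algebra.
From mathcomp Require Import all_classical all_reals all_analysis.
From mathcomp Require Import ring lra.
Import Order.TTheory GRing.Theory Num.Theory.
Import numFieldNormedType.Exports.
Local Open Scope classical_set_scope.
Local Open Scope ring_scope.

Set Implicit Arguments.
Unset Strict Implicit.
Unset Printing Implicit Defensive.

(** The manifold S^15 x S^1 carries the conformally flat structure of
    [(R^16 \ 0) / Z]: the radial direction of R^16 is sent to the circle
    direction. Concretely, at [p = (x, z)] the map
    [w |-> (w - <x, w> x, - <x, w> J z)], with [J] the rotation by a right angle,
    is an isometry of R^16 onto the tangent space, equivariant under
    Spin(9) x S^1; the sign in front of [J z] is dictated by the orientation.
    Its Spin(9)-orbit is the reduction. With [w] the preimage of the tangent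
    vector [X], the Levi-Civita form of this global frame is [x w^T - w x^T], whose
    coefficient on [I_a I_b I_c] is [<I_c I_b I_a x, w> / 8]; comparing with the
    factor 6, the vector field is the image of [x / 48]. In another local
    section the form changes by conjugation and by [h^T dh], which lies in
    spin(9).

    Transitivity on the sphere: the 9-dimensional spaces [R^9 x] and [R^9 y] meet
    in R^16, so [u x = v y] for unit vectors [u] and [v], whence [y = v u x]. *)

(** * Orthogonality of Clifford words *)

(** The nearly parallel condition ranges over every local section, and such a section differs from
    the global frame by a map into [Spin9], which is given only as a set of matrix products, without
    a smooth structure. That [h^T dh] has no component in m is therefore proved without
    one-parameter subgroups: conjugation by an element of [Spin9] preserves R^9, and differentiating
    a trace identity that expresses this kills every coefficient on a triple word. Coefficients are
    read off through the trace form: the 36 + 84 = 120 words of length two and three are orthogonal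
    of squared norm 16, so the coefficient of W in Z is tr(W^T Z) / 16. On [x w^T - w x^T] the two
    rank-one terms contribute equally, whence 2/16 = 1/8, and 6/48 = 1/8 fixes the length of the
    field. Regularity is stated by directional derivatives, while [dM] composes with [radial_proj];
    the chain rule asks for Frechet differentiability, hence the mean value argument for continuous
    partials. *)

Section CliffordWords.
Variables (R : realType) (I : 'I_9 -> 'M[R]_16).
Hypothesis hI : clifford9 I.

(** Letters are plain naturals rather than elements of ['I_9], so that parity conditions on words
    are closed boolean facts, settled by [vm_compute]. *)
Definition word (s : seq nat) : 'M[R]_16 := \prod_(a <- s) I (inord a).

Lemma word_nil : word [::] = 1%:M.
Proof. by rewrite /word big_nil. Qed.

Lemma word_cons a s : word (a :: s) = I (inord a) *m word s.
Proof. by rewrite /word big_cons mulmxE. Qed.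

Lemma word_cat s t : word (s ++ t) = word s *m word t.
Proof. by rewrite /word big_cat mulmxE. Qed.

Lemma word_rcons s a : word (rcons s a) = word s *m I (inord a).
Proof. by rewrite -cats1 word_cat word_cons word_nil mulmx1. Qed.

Lemma trmx_word s : (word s)^T = word (rev s).
Proof.
have [_ hT _] := hI; elim: s => [|a s IH]; first by rewrite word_nil trmx1.
by rewrite rev_cons word_rcons word_cons trmx_mul hT IH.
Qed.

Lemma word_revK s : word (rev s) *m word s = 1%:M.
Proof.
have [hS _ _] := hI; elim: s => [|a s IH]; first by rewrite word_nil mulmx1.
rewrite rev_cons word_rcons word_cons -mulmxA (mulmxA (I _)) hS mul1mx; exact: IH.
Qed.

Lemma word_commute s d : all (fun a => a < 9)%N s -> (d < 9)%N ->
  word s *m I (inord d) =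
  (-1) ^+ count (predC1 d) s *: (I (inord d) *m word s).
Proof.
have [_ _ hC] := hI; move=> + d9; elim: s => [|a s IH] /=.
  by rewrite word_nil mulmx1 mul1mx scale1r.
move=> /andP[a9 /IH {}IH]; rewrite word_cons -mulmxA IH.
rewrite -scalemxAr !mulmxA; case: eqP => [->|/eqP ad] /=; first by rewrite add0n.
rewrite hC; last by apply: contra ad => /eqP /(congr1 val); rewrite /= !inordK// => ->.
by rewrite add1n exprS mulN1r scaleNr mulNmx scalerN opprK.
Qed.

(** Such a word anticommutes with some [I d]; inserting [I d *m I d = 1] and using cyclicity of the
    trace shows that the trace equals its own opposite. *)
Lemma tr_word_eq0 s : all (fun a => a < 9)%N s ->
  has (fun d => odd (count (predC1 d) s)) (iota 0 9) -> \tr (word s) = 0.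
Proof.
have [hS _ _] := hI.
move=> s9 /hasP[d]; rewrite mem_iota => /= d9 odd_d.
suff : \tr (word s) = - \tr (word s) by lra.
rewrite -{1}[word s]mul1mx -(hS (inord d)) -mulmxA mxtrace_mulC.
rewrite -mulmxA word_commute// -scalemxAr mulmxA hS mul1mx.
by rewrite mxtraceZ -signr_odd odd_d mulN1r.
Qed.

End CliffordWords.

Definition pair_words : seq (seq nat) :=
  [seq [:: a; b] | a <- iota 0 9, b <- [seq b <- iota 0 9 | (a < b)%N]].

Definition triple_words : seq (seq nat) :=
  [seq [:: a; bc.1; bc.2] | a <- iota 0 9,
     bc <- [seq (b, c) | b <- [seq b <- iota 0 9 | (a < b)%N],
                         c <- [seq c <- iota 0 9 | (b < c)%N]]].

Definition skew_words := pair_words ++ triple_words.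

Definition upper_pairs : seq (nat * nat) :=
  [seq (i, j) | i <- iota 0 16, j <- [seq j <- iota 0 16 | (i < j)%N]].

Lemma sum_iota (V : nmodType) n (P : pred nat) (F : nat -> V) :
  \sum_(i <- iota 0 n | P i) F i = \sum_(i < n | P i) F i.
Proof. by rewrite -[in LHS](subn0 n) -[iota _ _]/(index_iota 0 n) big_mkord. Qed.

(** * The words of length two and three as an orthogonal basis of so(16) *)

Section Fierz.
Variables (R : realType) (I : 'I_9 -> 'M[R]_16).
Hypothesis hI : clifford9 I.
Local Notation word := (word I).

Lemma skew_words_lt9 w : w \in skew_words -> all (fun a => a < 9)%N w.
Proof.
have : all (all (fun a => a < 9)%N) skew_words by vm_compute.
by move=> /allP; apply.
Qed.

(** For words of equal length, take [d] occurring in exactly one of them; for lengths 2 and 3, take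
    [d] occurring in neither, which exists because at most five letters out of nine are used. *)
Lemma odd_swap_words w w' : w \in skew_words -> w' \in skew_words ->
  (w == w') || has (fun d => odd (count (predC1 d) (rev w ++ w'))) (iota 0 9).
Proof.
have H : all (fun w => all (fun w' => (w == w') ||
   has (fun d => odd (count (predC1 d) (rev w ++ w'))) (iota 0 9)) skew_words)
   skew_words by vm_compute.
by move=> ws ws'; exact: allP (allP H _ ws) _ ws'.
Qed.

Lemma tr_skew_words w w' : w \in skew_words -> w' \in skew_words ->
  \tr ((word w)^T *m word w') = 16 * (w == w')%:R.
Proof.
move=> ws ws'; have /orP[/eqP ->|h] := odd_swap_words ws ws'.
  by rewrite trmx_word// word_revK// mxtrace1 eqxx mulr1.
case: eqP => [->|_]; first by rewrite trmx_word// word_revK// mxtrace1 mulr1.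
rewrite trmx_word// -word_cat tr_word_eq0 ?mulr0//.
by rewrite all_cat all_rev !skew_words_lt9.
Qed.

(** Reversing two or three anticommuting letters takes one or three transpositions, an odd number in
    both cases. *)
Lemma trmx_skew_word w : w \in skew_words -> (word w)^T = - word w.
Proof.
have [_ hT hC] := hI.
have H : all (fun w => if w is a :: (b :: s) then
    [&& (a < b)%N, (b < 9)%N & if s is c :: t then
       [&& (b < c)%N, (c < 9)%N & t == [::]] else true]
   else false) skew_words by vm_compute.
have hC' a b : (a < b)%N -> (b < 9)%N ->
    I (inord b) *m I (inord a) = - (I (inord a) *m I (inord b)).
  move=> ab b9; apply: hC; rewrite -val_eqE /= !inordK//; last exact: ltn_trans ab b9.
  by rewrite gtn_eqF.
move=> ws; move: (allP H _ ws); case: w {ws} => [//|a [//|b [|c t]]].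
  move=> /and3P[ab b9 _].
  by rewrite !word_cons word_nil !mulmx1 trmx_mul !hT (hC' _ _ ab b9).
move=> /and3P[ab b9 /and3P[bc c9 /eqP ->]].
rewrite !word_cons word_nil !mulmx1 !trmx_mul !hT.
rewrite (hC' _ _ bc c9) mulNmx -mulmxA (hC' _ _ (ltn_trans ab bc) c9).
by rewrite mulmxN opprK !mulmxA (hC' _ _ ab b9) !mulNmx.
Qed.

Lemma big_upper_pairs (F : 'I_16 -> 'I_16 -> R) :
  \sum_(u <- upper_pairs) F (inord u.1) (inord u.2) =
  \sum_(i < 16) \sum_(j < 16 | (i < j)%N) F i j.
Proof.
rewrite /upper_pairs big_allpairs_dep sum_iota; apply: eq_bigr => i _.
by rewrite big_filter sum_iota; apply: eq_bigr => j _; rewrite !inord_val.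
Qed.

(** The diagonal of a skew matrix vanishes and the products of entries below it repeat those above,
    so the trace form is twice the Euclidean product of the upper triangles. *)
Lemma tr_skew (A B : 'M[R]_16) : A^T = - A -> B^T = - B ->
  \tr (A^T *m B) =
  2 * \sum_(u <- upper_pairs) A (inord u.1) (inord u.2) * B (inord u.1) (inord u.2).
Proof.
move=> /matrixP hA /matrixP hB.
rewrite (big_upper_pairs (fun i j => A i j * B i j)).
have -> : \tr (A^T *m B) = \sum_i \sum_j A i j * B i j.
  rewrite exchange_big; apply: eq_bigr => i _; rewrite mxE.
  by apply: eq_bigr => j _; rewrite mxE.
have sym i j : A i j * B i j = A j i * B j i.
  by move: (hA i j) (hB i j); rewrite !mxE => -> ->; rewrite mulrNN.
have diag i : A i i * B i i = 0.
  by move: (hA i i); rewrite !mxE => h; rewrite (_ : A i i = 0) ?mul0r//; lra.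
transitivity (\sum_(i < 16) (\sum_(j < 16 | (i < j)%N) A i j * B i j +
    \sum_(j < 16 | (j < i)%N) A i j * B i j)).
  apply: eq_bigr => i _; rewrite (bigID (fun j : 'I_16 => (i < j)%N)) /=.
  congr (_ + _); rewrite (bigID (fun j : 'I_16 => (j < i)%N)) /=.
  rewrite [X in _ + X]big1 ?addr0.
    by apply: eq_bigl => j; case: ltngtP.
  move=> j; rewrite -!leqNgt -eqn_leq => /eqP ij.
  by rewrite (val_inj ij).
rewrite big_split /= mulr_natl mulr2n; congr (_ + _).
rewrite [LHS](exchange_big_dep xpredT)//=; apply: eq_bigr => i _.
by apply: eq_bigr => j _.
Qed.

Lemma skew_matrix_eq (A B : 'M[R]_16) : A^T = - A -> B^T = - B ->
  (forall u, u \in upper_pairs ->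
     A (inord u.1) (inord u.2) = B (inord u.1) (inord u.2)) -> A = B.
Proof.
move=> /matrixP hA /matrixP hB h.
have lt (i j : 'I_16) : (i < j)%N -> A i j = B i j.
  move=> ij; have := h (i : nat, j : nat); rewrite /= !inord_val; apply.
  by apply/allpairsPdep; exists (i : nat), (j : nat);
    rewrite mem_filter !mem_iota /= ij !ltn_ord.
apply/matrixP => i j; case: (ltngtP i j) => [/lt//|/lt ji|/val_inj ->].
  by move: (hA j i) (hB j i); rewrite !mxE ji => -> ->.
by move: (hA j j) (hB j j); rewrite !mxE; lra.
Qed.

(* The 120 words of length 2 and 3 are orthogonal, and 120 is the dimension of
   so(16): the square matrix of their upper triangular entries is, up to a
   scalar, orthogonal, so its columns are orthogonal as well. *)
Lemma skew_decomposition (A : 'M[R]_16) : A^T = - A ->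
  A = 16^-1 *: \sum_(w <- skew_words) \tr ((word w)^T *m A) *: word w.
Proof.
move=> hA.
pose wd (k : 'I_120) := nth [::] skew_words k.
pose up (l : 'I_120) := nth (0, 0)%N upper_pairs l.
have szw : size skew_words = 120%N by vm_compute.
have szu : size upper_pairs = 120%N by vm_compute.
have wdP k : wd k \in skew_words by rewrite mem_nth// szw.
have uw : uniq skew_words by vm_compute.
have sumU (F : nat * nat -> R) : \sum_(u <- upper_pairs) F u = \sum_l F (up l).
  by rewrite (big_nth (0, 0)%N) szu big_mkord.
pose at_ (B : 'M[R]_16) (u : nat * nat) := B (inord u.1) (inord u.2).
pose K : 'M[R]_120 := \matrix_(k, l) at_ (word (wd k)) (up l).
(* Each word has trace norm 16, which is twice the squared length of its row of upper entries; the
   rows of [K] thus have squared length 8. *)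
have KKT : K *m (8^-1 *: K^T) = 1%:M.
  apply/matrixP => k l; rewrite -scalemxAr !mxE.
  have := tr_skew_words (wdP k) (wdP l).
  rewrite tr_skew ?trmx_skew_word// (sumU (fun u => at_ _ u * at_ _ u)).
  rewrite /wd nth_uniq ?szw// -/(wd k) -/(wd l) => h.
  rewrite (_ : \sum_j _ = \sum_l1 at_ (word (wd k)) (up l1) * at_ (word (wd l)) (up l1)).
    by move: h; rewrite -val_eqE /=; move: (\sum_l1 _) => x; case: eqP => _; lra.
  by apply: eq_bigr => j _; rewrite !mxE.
have KTK := mulmx1C KKT.
set S := \sum_(w <- _) _.
have skS : (16^-1 *: S)^T = - (16^-1 *: S).
  rewrite linearZ /= -scalerN; congr (_ *: _); rewrite /S raddf_sum /= -sumrN.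
  apply: eq_big_seq => w ws; rewrite linearZ /= trmx_skew_word//.
  by rewrite scalerN.
apply: skew_matrix_eq => // u us.
have [l -> {us}] : exists l, u = up l.
  have : (index u upper_pairs < 120)%N by rewrite -szu index_mem.
  by move=> h; exists (Ordinal h); rewrite /up nth_index.
rewrite -[LHS]/(at_ A (up l)) -[RHS]/(at_ (16^-1 *: S) (up l)).
have -> : at_ (16^-1 *: S) (up l) = 16^-1 * \sum_k
   (2 * \sum_m K k m * at_ A (up m)) * K k l.
  rewrite /at_ mxE; congr (_ * _).
  rewrite /S summxE (big_nth [::]) szw big_mkord; apply: eq_bigr => k _.
  rewrite mxE -/(wd k) tr_skew ?trmx_skew_word//.
  rewrite (sumU (fun u => at_ _ u * at_ _ u)); congr (_ * _ * _).
    by apply: eq_bigr => m _; rewrite mxE.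
  by rewrite mxE.
transitivity (\sum_m (m == l)%:R * at_ A (up m)).
  rewrite (bigD1 l) //= eqxx mul1r big1 ?addr0// => m /negbTE ->.
  by rewrite mul0r.
rewrite mulr_sumr.
under [RHS]eq_bigr => k _ do rewrite mulr_sumr mulr_suml mulr_sumr.
rewrite exchange_big; apply: eq_bigr => m _ /=.
transitivity (((8^-1 *: K^T) *m K) m l * at_ A (up m)).
  by rewrite KTK mxE.
rewrite -scalemxAl 2!mxE.
rewrite mulr_sumr mulr_suml; apply: eq_bigr => k _; rewrite mxE; lra.
Qed.

End Fierz.

(** * The splitting of so(16) *)

Section SpinAlgebra.
Variables (R : realType) (I : 'I_9 -> 'M[R]_16).
Hypothesis hI : clifford9 I.
Local Notation word := (word I).

Lemma word_pair (a b : 'I_9) : word [:: val a; val b] = I a *m I b.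
Proof. by rewrite !word_cons word_nil mulmx1 !inord_val. Qed.

Lemma word_triple (a b c : 'I_9) :
  word [:: val a; val b; val c] = I a *m I b *m I c.
Proof. by rewrite !word_cons word_nil mulmx1 !inord_val mulmxA. Qed.

Lemma mem_pair_words (a b : 'I_9) :
  (a < b)%N -> [:: val a; val b] \in pair_words.
Proof.
move=> ab; apply/allpairsPdep; exists (val a), (val b).
by rewrite mem_filter !mem_iota /= ab !ltn_ord.
Qed.

Lemma mem_triple_words (a b c : 'I_9) : (a < b)%N -> (b < c)%N ->
  [:: val a; val b; val c] \in triple_words.
Proof.
move=> ab bc; apply/allpairsPdep; exists (val a), (val b, val c).
split => //; first by rewrite mem_iota /= ltn_ord.
apply/allpairsPdep; exists (val b), (val c).
by rewrite !mem_filter !mem_iota /= ab bc !ltn_ord.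
Qed.

Lemma sum_triple_words (V : nmodType) (F : seq nat -> V) :
  \sum_(w <- triple_words) F w =
  \sum_(a < 9) \sum_(b < 9 | (a < b)%N) \sum_(c < 9 | (b < c)%N)
    F [:: val a; val b; val c].
Proof.
rewrite /triple_words big_allpairs_dep sum_iota; apply: eq_bigr => a _.
rewrite big_allpairs_dep big_filter sum_iota; apply: eq_bigr => b _.
by rewrite big_filter sum_iota.
Qed.

Lemma sum_pair_words (V : nmodType) (F : seq nat -> V) :
  \sum_(w <- pair_words) F w =
  \sum_(a < 9) \sum_(b < 9 | (a < b)%N) F [:: val a; val b].
Proof.
rewrite /pair_words big_allpairs_dep sum_iota; apply: eq_bigr => a _.
by rewrite big_filter sum_iota.
Qed.

Lemma spin9_algebra_ind (P : 'M[R]_16 -> Prop) :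
  P 0 -> (forall A B, P A -> P B -> P (A + B)) ->
  (forall k w, w \in pair_words -> P (k *: word w)) ->
  forall A, A \in spin9_algebra I -> P A.
Proof.
move=> P0 PD PZ A /memv_sumP[v hv ->].
apply: (big_ind P) => // a _.
have /memv_sumP[u hu ->] := hv a isT.
apply: (big_ind P) => // b ab.
have /vlineP[k ->] := hu b ab.
by rewrite -word_pair; apply/PZ/mem_pair_words.
Qed.

Lemma m_space_ind (P : 'M[R]_16 -> Prop) :
  P 0 -> (forall A B, P A -> P B -> P (A + B)) ->
  (forall k w, w \in triple_words -> P (k *: word w)) ->
  forall A, A \in m_space I -> P A.
Proof.
move=> P0 PD PZ A /memv_sumP[v hv ->].
apply: (big_ind P) => // a _.
have /memv_sumP[u hu ->] := hv a isT.
apply: (big_ind P) => // b ab.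
have /memv_sumP[t ht ->] := hu b ab.
apply: (big_ind P) => // c bc.
have /vlineP[k ->] := ht c bc.
by rewrite -word_triple; apply/PZ/mem_triple_words.
Qed.

Lemma mem_skew_words w :
  (w \in skew_words) = (w \in pair_words) || (w \in triple_words).
Proof. exact: mem_cat. Qed.

Lemma pair_word_skew w : w \in pair_words -> w \in skew_words.
Proof. by rewrite mem_skew_words => ->. Qed.

Lemma triple_word_skew w : w \in triple_words -> w \in skew_words.
Proof. by rewrite mem_skew_words orbC => ->. Qed.

Lemma pair_triple_words_neq w w' :
  w \in pair_words -> w' \in triple_words -> (w == w') = false.
Proof.
have /allP h2 : all (fun w => size w == 2%N) pair_words by vm_compute.
have /allP h3 : all (fun w => size w == 3%N) triple_words by vm_compute.
move=> /h2/eqP s2 /h3/eqP s3; apply/eqP => e.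
by move: s3; rewrite -e s2.
Qed.

Lemma spin9_algebra_tr0 A w : A \in spin9_algebra I -> w \in triple_words ->
  \tr ((word w)^T *m A) = 0.
Proof.
move=> As wt; move: A As; apply: spin9_algebra_ind.
- by rewrite mulmx0 mxtrace0.
- by move=> A B hA hB; rewrite mulmxDr mxtraceD hA hB addr0.
move=> k v vp; rewrite -scalemxAr mxtraceZ tr_skew_words//.
- by rewrite eq_sym pair_triple_words_neq// !mulr0.
- exact: triple_word_skew.
- exact: pair_word_skew.
Qed.

Lemma m_space_tr0 A w : A \in m_space I -> w \in pair_words ->
  \tr ((word w)^T *m A) = 0.
Proof.
move=> Am wp; move: A Am; apply: m_space_ind.
- by rewrite mulmx0 mxtrace0.
- by move=> A B hA hB; rewrite mulmxDr mxtraceD hA hB addr0.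
move=> k v vt; rewrite -scalemxAr mxtraceZ tr_skew_words//.
- by rewrite pair_triple_words_neq// !mulr0.
- exact: pair_word_skew.
- exact: triple_word_skew.
Qed.

Lemma m_space_skew A : A \in m_space I -> A^T = - A.
Proof.
move: A; apply: m_space_ind; first by rewrite trmx0 oppr0.
  by move=> A B hA hB; rewrite linearD /= hA hB opprD.
move=> k w wt; rewrite linearZ /= trmx_skew_word ?scalerN//.
exact: triple_word_skew.
Qed.

(** A common element is skew and trace-orthogonal to all 120 words, so every coefficient of its
    expansion is zero. *)
Lemma m_space_cap_spin9_algebra : (m_space I :&: spin9_algebra I = 0)%VS.
Proof.
apply/eqP; rewrite -subv0; apply/subvP => A /memv_capP[Am As].
rewrite memv0; apply/eqP.
rewrite (skew_decomposition hI (m_space_skew Am)).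
rewrite big1_seq ?scaler0// => w /andP[_]; rewrite mem_cat => /orP[wp|wt].
  by rewrite m_space_tr0// scale0r.
by rewrite spin9_algebra_tr0// scale0r.
Qed.

(** Cutting the orthogonal expansion by word length writes [A] as an element of spin(9) plus an
    element of m; as these meet only in 0, [daddv_pi] must return the second summand. *)
Lemma m_part_skew (A : 'M[R]_16) : A^T = - A ->
  m_part I A =
  16^-1 *: \sum_(w <- triple_words) \tr ((word w)^T *m A) *: word w.
Proof.
move=> hA; rewrite {1}(skew_decomposition hI hA) (big_cat _ pair_words) scalerDr.
set A2 := _ *: _; set A3 := _ *: _.
have A2s : A2 \in spin9_algebra I.
  rewrite /A2 memvZ// sum_pair_words memv_suml// => a _.
  rewrite memv_suml// => b ab; rewrite memvZ// word_pair memvE.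
  by apply: (sumv_sup a) => //; apply: (sumv_sup b).
have A3m : A3 \in m_space I.
  rewrite /A3 memvZ// sum_triple_words memv_suml// => a _.
  rewrite memv_suml// => b ab; rewrite memv_suml// => c bc.
  rewrite memvZ// word_triple memvE.
  by apply: (sumv_sup a) => //; apply: (sumv_sup b) => //; apply: (sumv_sup c).
have cap := m_space_cap_spin9_algebra.
rewrite /m_part linearD /= [X in _ + X]daddv_pi_id//.
(* The two complementary projections of [A2] add up to [A2], and the one onto spin(9) already fixes
   it, so the one onto m sends it to 0. *)
have : daddv_pi (m_space I) (spin9_algebra I) A2 +
       daddv_pi (spin9_algebra I) (m_space I) A2 = A2.
  by apply: daddv_pi_add => //; rewrite memvE (subv_trans _ (addvSr _ _)).
rewrite [X in _ + X]daddv_pi_id 1?capvC//.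
by move/(canRL (addrK _)) => ->; rewrite subrr add0r.
Qed.

End SpinAlgebra.

(** * The group Spin(9) *)

Section SpinGroup.
Variables (R : realType) (I : 'I_9 -> 'M[R]_16).
Hypothesis hI : clifford9 I.
Local Notation word := (word I).

Lemma dotE n (u v : 'cV[R]_n) : dot u v = \sum_i u i ord0 * v i ord0.
Proof. by rewrite /dot mxE; apply: eq_bigr => i _; rewrite mxE. Qed.

Lemma dotC n (u v : 'cV[R]_n) : dot u v = dot v u.
Proof. by rewrite !dotE; apply: eq_bigr => i _; rewrite mulrC. Qed.

Lemma dotDl n (u v w : 'cV[R]_n) : dot (u + v) w = dot u w + dot v w.
Proof. by rewrite /dot linearD mulmxDl mxE. Qed.

Lemma dotZl n k (u v : 'cV[R]_n) : dot (k *: u) v = k * dot u v.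
Proof. by rewrite /dot linearZ -scalemxAl mxE. Qed.

Lemma dotDr n (u v w : 'cV[R]_n) : dot w (u + v) = dot w u + dot w v.
Proof. by rewrite /dot mulmxDr mxE. Qed.

Lemma dotZr n k (u v : 'cV[R]_n) : dot u (k *: v) = k * dot u v.
Proof. by rewrite /dot -scalemxAr mxE. Qed.

Lemma dotNl n (u v : 'cV[R]_n) : dot (- u) v = - dot u v.
Proof. by rewrite -scaleN1r dotZl mulN1r. Qed.

Lemma dotNr n (u v : 'cV[R]_n) : dot u (- v) = - dot u v.
Proof. by rewrite dotC dotNl dotC. Qed.

Lemma dot0l n (u : 'cV[R]_n) : dot 0 u = 0.
Proof. by rewrite -(scale0r u) dotZl mul0r. Qed.

Lemma dot_mulmxl m n (A : 'M[R]_(m, n)) u v : dot (A *m u) v = dot u (A^T *m v).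
Proof. by rewrite /dot trmx_mul mulmxA. Qed.

Lemma dot_ge0 n (u : 'cV[R]_n) : 0 <= dot u u.
Proof. by rewrite dotE sumr_ge0// => i _; rewrite -expr2 sqr_ge0. Qed.

Lemma dot_eq0 n (u : 'cV[R]_n) : (dot u u == 0) = (u == 0).
Proof.
apply/idP/eqP => [|->]; last by rewrite dot0l.
rewrite dotE psumr_eq0 => [/allP h|i _]; last by rewrite -expr2 sqr_ge0.
apply/matrixP => i j; rewrite ord1 mxE; apply/eqP.
by have := h i (mem_index_enum _); rewrite -expr2 sqrf_eq0.
Qed.

Lemma mulmx_dot n (u v : 'cV[R]_n) : u^T *m v = (dot u v)%:M.
Proof. by rewrite /dot [LHS]mx11_scalar. Qed.

Definition cvec (c : 'cV[R]_9) : 'M[R]_16 := \sum_(a < 9) c a ord0 *: I a.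

Lemma cvecD c d : cvec (c + d) = cvec c + cvec d.
Proof. by rewrite /cvec -big_split; apply: eq_bigr => a _; rewrite mxE scalerDl. Qed.

Lemma cvecZ k c : cvec (k *: c) = k *: cvec c.
Proof. by rewrite /cvec scaler_sumr; apply: eq_bigr => a _; rewrite mxE scalerA. Qed.

Lemma cvecN c : cvec (- c) = - cvec c.
Proof. by rewrite -scaleN1r cvecZ scaleN1r. Qed.

Lemma cvec_delta a : cvec (delta_mx a ord0) = I a.
Proof.
rewrite /cvec (bigD1 a)//= mxE !eqxx scale1r big1 ?addr0// => b /negbTE ba.
by rewrite mxE ba scale0r.
Qed.

Lemma trmx_cvec c : (cvec c)^T = cvec c.
Proof.
have [_ hT _] := hI; rewrite /cvec raddf_sum; apply: eq_bigr => a _ /=.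
by rewrite linearZ /= hT.
Qed.

Lemma clifford_relation a b :
  I a *m I b + I b *m I a = (2 * (a == b)%:R)%:M.
Proof.
have [hS _ hC] := hI; case: (eqVneq a b) => [->|ab].
  by rewrite hS mulr1 -raddfD.
by rewrite hC// addNr mulr0 raddf0.
Qed.

Lemma cvec_anticomm c d :
  cvec c *m cvec d + cvec d *m cvec c = (2 * dot c d)%:M.
Proof.
rewrite /cvec !mulmx_suml.
under eq_bigr => a _ do rewrite mulmx_sumr.
under [X in _ + X]eq_bigr => a _ do rewrite mulmx_sumr.
rewrite [X in _ + X]exchange_big -big_split dotE /= mulr_sumr raddf_sum /=.
apply: eq_bigr => a _; rewrite -big_split /= (bigD1 a)//= big1 ?addr0.
  rewrite -!scalemxAl -!scalemxAr !scalerA [d _ _ * _]mulrC -scalerDr.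
  by rewrite clifford_relation eqxx mulr1 scale_scalar_mx mulrC.
move=> b ba; rewrite -!scalemxAl -!scalemxAr !scalerA [d _ _ * _]mulrC -scalerDr.
by rewrite clifford_relation eq_sym (negbTE ba) mulr0 raddf0 scaler0.
Qed.

Lemma cvec_sqr c : cvec c *m cvec c = (dot c c)%:M.
Proof.
have := cvec_anticomm c c.
move/(congr1 (fun X => 2^-1 *: X)).
rewrite -[X in _ *: X]mulr2n -[X in _ *: X]scaler_nat scalerA mulVf ?pnatr_eq0//.
by rewrite scale1r scale_scalar_mx mulrA mulVf ?pnatr_eq0// mul1r.
Qed.

(** Conjugation by a unit vector of R^9 is minus the reflection in its orthogonal hyperplane. In
    particular it maps R^9 to itself, which is the source of [Spin9_conj] and of the determinant
    computation. *)
Lemma cvec_conj c d : dot c c = 1 ->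
  cvec c *m cvec d *m cvec c = cvec ((2 * dot c d) *: c - d).
Proof.
move=> c1; have /(canRL (addrK _)) -> := cvec_anticomm c d.
rewrite mulmxBl -mulmxA cvec_sqr c1 mulmx1 mul_scalar_mx.
by rewrite cvecD cvecN cvecZ.
Qed.

Lemma unit9P u : unit9 I u -> exists2 c, dot c c = 1 & u = cvec c.
Proof. by move=> [c c1 ->]; exists c. Qed.

Lemma unit9_sqr u : unit9 I u -> u *m u = 1%:M.
Proof. by move=> /unit9P[c c1 ->]; rewrite cvec_sqr c1. Qed.

Lemma trmx_unit9 u : unit9 I u -> u^T = u.
Proof. by move=> /unit9P[c _ ->]; rewrite trmx_cvec. Qed.

Lemma Spin9_1 : Spin9 I 1%:M.
Proof. by exists [::]; split => //; rewrite big_nil. Qed.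

Lemma Spin9_mul g h : Spin9 I g -> Spin9 I h -> Spin9 I (g *m h).
Proof.
move=> [s [os us ->]] [t [ot ut ->]]; exists (s ++ t); split.
- by rewrite size_cat oddD (negbTE os) (negbTE ot).
- by move=> u; rewrite mem_cat => /orP[/us|/ut].
- by rewrite big_cat mulmxE.
Qed.

Lemma Spin9_trmx g : Spin9 I g -> Spin9 I g^T.
Proof.
move=> [s [os us ->]]; exists (rev s); split.
- by rewrite size_rev.
- by move=> u; rewrite mem_rev => /us.
elim: s us {os} => [|u s IH] us; first by rewrite !big_nil trmx1.
rewrite rev_cons big_cons -cats1 big_cat big_seq1 -!mulmxE trmx_mul.
rewrite (trmx_unit9 (us u (mem_head _ _))) IH// => v vs.
by apply: us; rewrite inE vs orbT.
Qed.

Lemma Spin9_orthogonal g : Spin9 I g -> g^T *m g = 1%:M.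
Proof.
move=> [s [_ us ->]]; elim: s us => [|u s IH] us.
  by rewrite big_nil trmx1 mulmx1.
have uu := us u (mem_head _ _).
rewrite big_cons -mulmxE trmx_mul (trmx_unit9 uu).
rewrite -mulmxA (mulmxA u) (unit9_sqr uu) mul1mx IH// => v vs.
by apply: us; rewrite inE vs orbT.
Qed.

Lemma Spin9_orthogonalr g : Spin9 I g -> g *m g^T = 1%:M.
Proof. by move=> /Spin9_orthogonal/mulmx1C. Qed.

Lemma Spin9_conj g c : Spin9 I g -> exists d, g *m cvec c *m g^T = cvec d.
Proof.
move=> [s [_ us ->]]; elim: s us => [|u s IH] us.
  by exists c; rewrite big_nil trmx1 mulmx1 mul1mx.
have us1 : unit9 I u by apply: us; rewrite mem_head.
case: IH => [v vs|d hd]; first by apply: us; rewrite inE vs orbT.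
rewrite big_cons -mulmxE trmx_mul (trmx_unit9 us1).
move: (\prod_(v <- s) v) hd => P hd.
have -> : u *m P *m cvec c *m (P^T *m u) = u *m (P *m cvec c *m P^T) *m u.
  by rewrite !mulmxA.
rewrite hd; have [e e1 ->] := unit9P us1.
by eexists; exact: cvec_conj.
Qed.

(** The conjugate of [I d] is a combination of the [I e], and each [I e] times the four letters is a
    word of length five. Some letter [f] out of nine does not occur in it, and [I f] then crosses
    the word with five signs, so the trace vanishes. This linear trace condition is the form in
    which invariance of R^9 gets differentiated. *)
Lemma Spin9_tr4 g (a b c d : 'I_9) : Spin9 I g -> (a < b)%N -> (b < c)%N ->
  d \notin [:: a; b; c] ->
  \tr (g *m I d *m g^T *m (I a *m I b *m I c *m I d)) = 0.
Proof.
move=> gS ab bc dabc.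
have [v hv] := Spin9_conj (delta_mx d ord0) gS.
rewrite -cvec_delta {}hv cvec_delta /cvec mulmx_suml raddf_sum big1// => e _ /=.
rewrite -scalemxAl mxtraceZ.
have -> : I e *m (I a *m I b *m I c *m I d) =
   word [:: val e; val a; val b; val c; val d].
  by rewrite !word_cons word_nil mulmx1 !inord_val !mulmxA.
rewrite tr_word_eq0 ?mulr0 //=; first by rewrite !ltn_ord.
have H : all (fun e => all (fun w => all (fun d => (d \in w) ||
   has (fun f => odd (count (predC1 f) (e :: rcons w d))) (iota 0 9))
   (iota 0 9)) triple_words) (iota 0 9) by vm_compute.
have lt9 (i : 'I_9) : val i \in iota 0 9 by rewrite mem_iota /=.
have dw : (val d \in [:: val a; val b; val c]) = false.
  by rewrite -[[:: _; _; _]]/(map val [:: a; b; c]) (mem_map val_inj) (negbTE dabc).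
have /allP/(_ _ (mem_triple_words ab bc))/allP/(_ _ (lt9 d)) := allP H _ (lt9 e).
by rewrite dw.
Qed.

(** Two unit vectors that are not antipodal are conjugate by the unit vector bisecting them, whose
    square is 1; antipodal ones have equal determinants because 16 is even. *)
Lemma det_unit9 u v : unit9 I u -> unit9 I v -> \det u = \det v.
Proof.
move=> /unit9P[c c1 ->] /unit9P[d d1 ->].
have [/eqP|cd0] := eqVneq (c + d) 0.
  rewrite addr_eq0 => /eqP ->; rewrite cvecN -scaleN1r detZ.
  by rewrite -signr_odd mul1r.
have n2 : dot (c + d) (c + d) = 2 + 2 * dot c d.
  by rewrite dotDl !dotDr c1 d1 (dotC d c); ring.
have n0 : 0 < dot (c + d) (c + d) by rewrite lt_neqAle dot_ge0 eq_sym dot_eq0 cd0.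
pose k := (Num.sqrt (dot (c + d) (c + d)))^-1.
have k2 : k * k * dot (c + d) (c + d) = 1.
  by rewrite /k -invfM -expr2 sqr_sqrtr ?dot_ge0// mulVf// gt_eqF.
pose w := k *: (c + d).
have w1 : dot w w = 1 by rewrite dotZl dotZr mulrA.
(* Since |c + d|^2 = 2 <c + d, c>, the product 2 <w, c> w is [c + d], and subtracting [c] leaves
   [d]. *)
have hw : cvec w *m cvec c *m cvec w = cvec d.
  rewrite cvec_conj//; congr cvec.
  rewrite /w dotZl dotDl c1 (dotC d c) scalerA.
  rewrite (_ : 2 * _ * k = 1); first by rewrite scale1r addrC addrA addNr add0r.
  by apply: etrans k2; rewrite n2; ring.
rewrite -hw !det_mulmx mulrAC -det_mulmx cvec_sqr w1 det1 mul1r //.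
Qed.

(** An even number of factors share one determinant, whose square is 1. This is what keeps the
    Spin(9)-orbit of a positive frame positive. *)
Lemma det_Spin9 g : Spin9 I g -> \det g = 1.
Proof.
have u0 : unit9 I (I ord0).
  exists (delta_mx ord0 ord0); last by rewrite -/(cvec _) cvec_delta.
  rewrite dotE (bigD1 ord0)//= mxE !eqxx mulr1 big1 ?addr0// => a /negbTE a0.
  by rewrite mxE a0 mul0r.
have e2 : \det (I ord0) ^+ 2 = 1.
  by rewrite expr2 -det_mulmx unit9_sqr// det1.
move=> [s [os us ->]].
have -> : \det (\prod_(u <- s) u) = \det (I ord0) ^+ size s.
  elim: s us {os} => [|u s IH] us; first by rewrite big_nil det1.
  rewrite big_cons -mulmxE det_mulmx exprS IH.
    by rewrite (det_unit9 (us u (mem_head _ _)) u0).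
  by move=> v vs; apply: us; rewrite inE vs orbT.
by rewrite -(odd_double_half (size s)) (negbTE os) add0n -mul2n exprM e2 expr1n.
Qed.

Lemma dot_cvec c x : dot (cvec c *m x) (cvec c *m x) = dot c c * dot x x.
Proof.
by rewrite dot_mulmxl trmx_cvec mulmxA cvec_sqr mul_scalar_mx dotZr.
Qed.

Lemma Spin9_transitive x y : dot x x = 1 -> dot y y = 1 ->
  exists2 g, Spin9 I g & g *m x = y.
Proof.
move=> x1 y1.
pose X : 'M[R]_(16, 9) := \matrix_(i, a) (I a *m x) i ord0.
pose Y : 'M[R]_(16, 9) := \matrix_(i, a) (I a *m y) i ord0.
have XE (z : 'cV[R]_16) (c : 'cV[R]_9) :
    (\matrix_(i, a) (I a *m z) i ord0) *m c = cvec c *m z.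
  apply/matrixP => i j; rewrite (ord1 j) mxE /cvec mulmx_suml summxE.
  by apply: eq_bigr => a _; rewrite -scalemxAl [RHS]mxE [LHS]mulrC mxE.
(* Eighteen columns in R^16 are linearly dependent: this is the intersection of R^9 x and R^9 y. *)
have [v v0 hv] : exists2 v : 'cV[R]_(9 + 9), v != 0 & row_mx X Y *m v = 0.
  have : kermx (row_mx X Y)^T != 0.
    rewrite -mxrank_eq0 mxrank_ker subn_eq0 -ltnNge.
    by rewrite (leq_ltn_trans (rank_leq_col _)).
  case/rowV0Pn => v /sub_kermxP hv v0; exists v^T; first by rewrite trmx_eq0.
  by rewrite -[row_mx X Y]trmxK -trmx_mul hv trmx0.
pose c := usubmx v; pose d := - dsubmx v.
have cd : cvec c *m x = cvec d *m y.
  move: hv; rewrite -[v]vsubmxK mul_row_col !XE.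
  by move/eqP; rewrite addr_eq0 => /eqP ->; rewrite /d cvecN mulNmx.
have ncd : dot c c = dot d d.
  have := congr1 (fun z => dot z z) cd.
  by rewrite /= !dot_cvec x1 y1 !mulr1.
have c0 : c != 0.
  apply: contra v0 => /eqP c0; move: ncd; rewrite c0 dot0l => /esym/eqP.
  rewrite dot_eq0 oppr_eq0 => /eqP d0.
  by rewrite -[v]vsubmxK -/c c0 d0 col_mx0.
have n0 : 0 < dot c c by rewrite lt_neqAle dot_ge0 eq_sym dot_eq0 c0.
pose k := (Num.sqrt (dot c c))^-1.
have k2 : k * (k * dot c c) = 1.
  by rewrite mulrA /k -invfM -expr2 sqr_sqrtr ?dot_ge0// mulVf// gt_eqF.
(* Applying [cvec d] to [cvec c *m x = cvec d *m y] gives |d|^2 y on the right, with |c| = |d|; the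
   two factors [k] normalise both vectors at once. *)
exists (cvec (k *: d) *m cvec (k *: c)).
  exists [:: cvec (k *: d); cvec (k *: c)]; split => //.
    move=> u; rewrite !inE => /orP[/eqP ->|/eqP ->].
      by exists (k *: d) => //; rewrite dotZl dotZr -ncd.
    by exists (k *: c) => //; rewrite dotZl dotZr.
  by rewrite !big_cons big_nil mulr1 mulmxE.
rewrite -mulmxA (cvecZ k c) -scalemxAl cd cvecZ -scalemxAl -scalemxAr mulmxA.
by rewrite cvec_sqr -ncd mul_scalar_mx !scalerA k2 scale1r.
Qed.

Lemma sphere_eq_quotient_spin9 : sphere_eq_quotient I.
Proof.
move=> x x1; split.
- by move=> g /Spin9_orthogonal gg; rewrite dot_mulmxl mulmxA gg mul1mx.
- by move=> y y1; exact: Spin9_transitive.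
move=> g h gS hS; split => [e|[k [_ kx] ->]]; last by rewrite -mulmxA kx.
exists (g^T *m h); last by rewrite mulmxA Spin9_orthogonalr// mul1mx.
split; first exact/Spin9_mul/hS/Spin9_trmx.
by rewrite -mulmxA -e mulmxA Spin9_orthogonal// mul1mx.
Qed.

End SpinGroup.

(** * Continuous partial derivatives imply differentiability *)

Section ContinuouslyDifferentiable.
Variables (R : realType) (n : nat).
Local Notation V := 'cV[R]_n.
Local Notation e_ i := (delta_mx i ord0 : V).

Lemma is_derive_line (W : normedModType R) (f : V -> W) (q v : V) (t : R) :
  derivable f (q + t *: v) v ->
  is_derive t 1 (fun s : R => f (q + s *: v)) ('D_v f (q + t *: v)).
Proof.
have E : (fun h : R => h^-1 *: (((fun s : R => f (q + s *: v)) \o shift t) (h *: (1 : R)) -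
      f (q + t *: v))) =
    (fun h : R => h^-1 *: ((f \o shift (q + t *: v)) (h *: v) - f (q + t *: v))).
  apply/funext => h /=; rewrite /shift /= scalerDl.
  by congr (_ *: (f _ - _)); rewrite [_ *: (1 : R)]mulr1 addrCA.
move=> df; split; first by rewrite /derivable E.
by rewrite /derive E.
Qed.

Lemma mean_value_line (f : V -> R^o) (q v : V) (a : R) :
  (forall t, `|t| <= `|a| -> derivable f (q + t *: v) v) ->
  exists2 c, `|c| <= `|a| & f (q + a *: v) - f q = a * 'D_v f (q + c *: v).
Proof.
move=> df.
pose phi (s : R) : R := f (q + s *: v).
have dphi (t : R) : `|t| <= `|a| -> is_derive t 1 phi ('D_v f (q + t *: v)).
  by move=> ta; apply: is_derive_line; exact: df.
have cphi (x y : R) : (forall t, t \in `[x, y]%R -> `|t| <= `|a|) ->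
    {within `[x, y], continuous phi}.
  move=> h; apply: derivable_within_continuous => t /h ta.
  by have [] := dphi t ta.
have phi0 : phi 0 = f q by rewrite /phi scale0r addr0.
have [a0|a0] := leP 0 a.
  have h (t : R) : t \in `[0, a]%R -> `|t| <= `|a|.
    by rewrite in_itv /= => /andP[t0 ta]; rewrite !ger0_norm.
  have [|t /h ta e] := @MVT_segment _ phi (fun t => 'D_v f (q + t *: v)) 0 a a0 _ (cphi _ _ h).
    by move=> t ta; apply: dphi; apply: h; exact: subset_itv_oo_cc ta.
  by exists t => //; rewrite -phi0 -/(phi a) e subr0 mulrC.
have h (t : R) : t \in `[a, 0]%R -> `|t| <= `|a|.
  rewrite in_itv /= => /andP[ta t0]; rewrite !ler0_norm ?lerN2//; exact: ltW.
have [|t /h ta e] := @MVT_segment _ phi (fun t => 'D_v f (q + t *: v)) a 0 (ltW a0) _ (cphi _ _ h).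
  by move=> t ta; apply: dphi; apply: h; exact: subset_itv_oo_cc ta.
exists t => //; rewrite -phi0 -/(phi a) -opprB e sub0r; ring.
Qed.

Lemma cV_sum_delta (h : V) : h = \sum_i h i ord0 *: e_ i.
Proof.
apply/matrixP => i j; rewrite ord1 summxE (bigD1 i)//= !mxE !eqxx mulr1.
by rewrite big1 ?addr0// => k /negbTE ki; rewrite !mxE eq_sym ki mulr0.
Qed.

Lemma norm_coord_le (h : V) i : `|h i ord0| <= `|h|.
Proof.
by rewrite [leRHS]/Num.Def.normr/= mx_normrE (le_bigmax _ _ (i, ord0)).
Qed.

Lemma norm_cV_le (h : V) e : 0 <= e -> (forall i, `|h i ord0| <= e) -> `|h| <= e.
Proof.
move=> e0 he; rewrite [leLHS]/Num.Def.normr/= mx_normrE.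
by apply: bigmax_le => // -[i j] _; rewrite /= ord1.
Qed.

(** The increment is split along a staircase of coordinate segments from [p] to [p + h]; on each,
    the mean value theorem replaces the difference by a nearby partial derivative. This is the
    bridge from [Cn], which speaks of directional derivatives, to the chain rule. *)
Lemma continuous_partials_differentiable (f : V -> R^o) (p : V) :
  (forall i, \forall q \near p, derivable f q (e_ i)) ->
  (forall i, {for p, continuous (fun q => 'D_(e_ i) f q)}) ->
  differentiable f p.
Proof.
move=> df cf; pose g i (q : V) : R := 'D_(e_ i) f q.
pose L (h : V) : R^o := \sum_i h i ord0 *: ('D_(e_ i) f p : R^o).
have Llin : linear L.
  move=> k u v; rewrite /L scaler_sumr -big_split; apply: eq_bigr => i _ /=.
  by rewrite !mxE scalerDl scalerA.
pose LL : {linear V -> R^o} := HB.pack L (GRing.isLinear.Build _ _ _ _ _ Llin).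
have Lc : continuous LL.
  move=> x; apply: (@differentiable_continuous _ _ _ x L).
  rewrite /L (_ : (fun _ => _) = \sum_i (fun h : V => h i ord0 *: ('D_(e_ i) f p : R^o))).
    apply: differentiable_sum => i; apply: differentiableZl.
    exact: differentiable_coord.
  by apply/funext => h; rewrite fct_sumE.
suff fL : f \o shift p = cst (f p) + (LL : V -> R^o) +o_ (0 : V) id.
  by apply/diff_locallyP; rewrite (diff_unique Lc fL).
apply/eqaddoP => _/posnumP[e].
have n0 : 0 < (n.+1)%:R :> R by rewrite ltr0n.
(* The [n] errors sum to n/(n+1) times the allowed one; dividing by [n.+1] rather than [n] also
   covers dimension 0. *)
have nearp : \forall q \near p, forall i, derivable f q (e_ i) /\
    `|g i q - g i p| <= e%:num / n.+1%:R.
  have h i : \forall q \near p, derivable f q (e_ i) /\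
      `|g i q - g i p| <= e%:num / n.+1%:R.
    apply: filterI; first exact: df.
    have en0 : 0 < e%:num / n.+1%:R by rewrite divr_gt0.
    have /cvgrPdist_le/(_ _ en0) := cf i.
    by apply: filterS => q; rewrite distrC.
  exact: (@filter_forall V 'I_n _ (nbhs p) _ h).
have [r /= r0 hr] := (nbhs_ballP _ _).1 nearp.
have {}hr (q : V) : `|q - p| < r -> forall i, derivable f q (e_ i) /\
    `|g i q - g i p| <= e%:num / n.+1%:R.
  by move=> qp; apply: hr; rewrite -ball_normE /= distrC.
near=> h.
have hsmall : `|h| < r by near: h; apply/nbhs_ballP; exists r => // h;
  rewrite -ball_normE /= sub0r normrN.
(* Corner number [k] of the staircase: [h] with its coordinates from [k] on set to 0. *)
pose hk (k : nat) : V := \col_i (if (i < k)%N then h i ord0 else 0).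
have hk0 : hk 0%N = 0 by apply/matrixP => i j; rewrite !mxE.
have hkn : hk n = h.
  by apply/matrixP => i j; rewrite ord1 !mxE ltn_ord.
have hkS (i : 'I_n) : hk i.+1 = hk i + h i ord0 *: e_ i.
  apply/matrixP => j j'; rewrite ord1 !mxE eqxx andbT ltnS -val_eqE /=.
  by case: (ltngtP j i) => [ji|ji|/val_inj ->]; rewrite ?mulr0 ?addr0 ?mulr1 ?add0r.
have step (i : 'I_n) : `|f (p + hk i.+1) - f (p + hk i) - h i ord0 * g i p|
     <= e%:num / n.+1%:R * `|h|.
  (* For the sup norm, each point of the staircase is at distance at most |h| from [p], so the whole
     path stays in the good ball. *)
  have inr t : `|t| <= `|h i ord0| -> `|p + hk i + t *: e_ i - p| < r.
    move=> ti; rewrite -(addrA p) [p + _]addrC addrK.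
    apply: le_lt_trans hsmall; apply: norm_cV_le => // j; rewrite !mxE eqxx andbT.
    case: (ltngtP j i) => [ji|ji|/val_inj ->].
    - by rewrite -val_eqE /= (ltn_eqF ji) mulr0 addr0 norm_coord_le.
    - by rewrite -val_eqE /= (gtn_eqF ji) mulr0 addr0 normr0.
    - by rewrite eqxx mulr1 add0r (le_trans ti)// norm_coord_le.
  have [|c ci] := @mean_value_line f (p + hk i) (e_ i) (h i ord0).
    by move=> t /inr/hr/(_ i)[].
  rewrite -addrA -hkS => ->; rewrite -mulrBr normrM mulrC.
  by apply: ler_pM => //; [have [] := hr _ (inr c ci) i|exact: norm_coord_le].
have -> : (f \o shift p - (cst (f p) + LL)) h =
  \sum_(i < n) (f (p + hk i.+1) - f (p + hk i) - h i ord0 * g i p).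
  rewrite sumrB -(big_mkord xpredT (fun i => f (p + hk i.+1) - f (p + hk i))).
  rewrite telescope_sumr// hkn hk0 addr0.
  rewrite -[LHS]/(f (h + p) - (f p + L h)) /L opprD addrA addrC [h + p]addrC.
  by rewrite addrC.
apply: le_trans (ler_norm_sum _ _ _) _.
apply: (@le_trans _ _ (\sum_(i < n) e%:num / n.+1%:R * `|h|)).
  by apply: ler_sum => i _; exact: step.
rewrite sumr_const card_ord -[leLHS]mulr_natl mulrA; apply: ler_wpM2r => //.
rewrite mulrCA ger_pMr// ler_pdivrMr// mul1r ler_nat//.
Unshelve. all: by end_near. Qed.

End ContinuouslyDifferentiable.

(** * Calculus of matrix-valued maps *)

Section MatrixDerivatives.
Variables (R : realType) (V : normedModType R).

Lemma is_derive_mxP m n (A : V -> 'M[R]_(m, n)) (x v : V) (dA : 'M[R]_(m, n)) :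
  is_derive x v A dA <->
  forall i j, is_derive x v (fun q => A q i j : R^o) (dA i j).
Proof.
split=> [[dA1 <-] i j|h].
  split; first exact: (derivable_mxP _ _ _).1.
  by rewrite derive_mx// mxE.
have dA1 : derivable A x v by apply/derivable_mxP => i j; have [] := h i j.
split=> //; rewrite derive_mx//; apply/matrixP => i j; rewrite mxE.
by have [] := h i j.
Qed.

Lemma is_derive_ext (W : normedModType R) (f g : V -> W) (x v : V) df :
  f =1 g -> is_derive x v f df -> is_derive x v g df.
Proof. by move=> /funext ->. Qed.

Lemma is_derive_mul (f g : V -> R^o) (x v : V) (df dg : R^o) :
  is_derive x v f df -> is_derive x v g dg ->
  is_derive x v (fun q => f q * g q : R^o) (df * g x + f x * dg : R).
Proof.
move=> hf hg; have := @is_deriveM _ _ f g x v df dg hf hg.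
by congr is_derive; rewrite addrC; congr (_ + _); rewrite mulrC.
Qed.

Lemma is_derive_sumr (T : Type) (r : seq T) (f : T -> V -> R^o) (df : T -> R^o)
    (x v : V) : (forall k, is_derive x v (f k) (df k)) ->
  is_derive x v (fun q => \sum_(k <- r) f k q) (\sum_(k <- r) df k).
Proof.
move=> h; elim: r => [|k r IH].
  rewrite big_nil; apply: (is_derive_ext (f := cst 0)) (@is_derive_cst _ V R^o 0 x v).
  by move=> q; rewrite big_nil.
rewrite big_cons; apply: is_derive_ext (is_deriveD (h k) IH) => q.
by rewrite big_cons.
Qed.

Lemma is_derive_mulmx m n p (A : V -> 'M[R]_(m, n)) (B : V -> 'M[R]_(n, p))
    (x v : V) dA dB : is_derive x v A dA -> is_derive x v B dB ->
  is_derive x v (fun q => A q *m B q) (dA *m B x + A x *m dB).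
Proof.
move=> /is_derive_mxP hA /is_derive_mxP hB; apply/is_derive_mxP => i j.
rewrite !mxE -big_split /=.
apply: (is_derive_ext (f := fun q => \sum_k A q i k * B q k j)).
  by move=> q; rewrite mxE.
by apply: is_derive_sumr => k; apply: is_derive_mul.
Qed.

Lemma is_derive_trmx m n (A : V -> 'M[R]_(m, n)) (x v : V) dA :
  is_derive x v A dA -> is_derive x v (fun q => (A q)^T) dA^T.
Proof.
move=> /is_derive_mxP h; apply/is_derive_mxP => i j; rewrite mxE.
by apply: is_derive_ext (h j i) => q; rewrite mxE.
Qed.

Lemma is_derive_usubmx m1 m2 n (A : V -> 'M[R]_(m1 + m2, n)) (x v : V) dA :
  is_derive x v A dA -> is_derive x v (fun q => usubmx (A q)) (usubmx dA).
Proof.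
move=> /is_derive_mxP h; apply/is_derive_mxP => i j; rewrite mxE.
by apply: is_derive_ext (h (lshift m2 i) j) => q; rewrite mxE.
Qed.

Lemma is_derive_dsubmx m1 m2 n (A : V -> 'M[R]_(m1 + m2, n)) (x v : V) dA :
  is_derive x v A dA -> is_derive x v (fun q => dsubmx (A q)) (dsubmx dA).
Proof.
move=> /is_derive_mxP h; apply/is_derive_mxP => i j; rewrite mxE.
by apply: is_derive_ext (h (rshift m1 i) j) => q; rewrite mxE.
Qed.

Lemma is_derive_col m n (A : V -> 'M[R]_(m, n)) (x v : V) dA j :
  is_derive x v A dA -> is_derive x v (fun q => col j (A q)) (col j dA).
Proof.
move=> /is_derive_mxP h; apply/is_derive_mxP => i k; rewrite mxE.
by apply: is_derive_ext (h i j) => q; rewrite mxE.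
Qed.

Lemma is_derive_col_mx m1 m2 n (A : V -> 'M[R]_(m1, n)) (B : V -> 'M[R]_(m2, n))
    (x v : V) dA dB : is_derive x v A dA -> is_derive x v B dB ->
  is_derive x v (fun q => col_mx (A q) (B q)) (col_mx dA dB).
Proof.
move=> /is_derive_mxP hA /is_derive_mxP hB; apply/is_derive_mxP => i j.
case: (split_ordP i) => k ->.
  rewrite col_mxEu; apply: is_derive_ext (hA k j) => q; by rewrite col_mxEu.
rewrite col_mxEd; apply: is_derive_ext (hB k j) => q; by rewrite col_mxEd.
Qed.

Lemma is_derive_scalemx m n (f : V -> R^o) (A : V -> 'M[R]_(m, n))
    (x v : V) (df : R^o) dA : is_derive x v f df -> is_derive x v A dA ->
  is_derive x v (fun q => f q *: A q) ((df : R) *: A x + (f x : R) *: dA).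
Proof.
move=> hf /is_derive_mxP hA; apply/is_derive_mxP => i j; rewrite !mxE.
apply: (is_derive_ext (f := fun q => f q * A q i j : R^o)).
  by move=> q; rewrite mxE.
exact: is_derive_mul.
Qed.

Lemma is_derive_mxtrace n (A : V -> 'M[R]_n) (x v : V) dA :
  is_derive x v A dA -> is_derive x v (fun q => \tr (A q) : R^o) (\tr dA).
Proof. by move=> /is_derive_mxP h; apply: is_derive_sumr. Qed.

Lemma is_derive_dot n (A B : V -> 'cV[R]_n) (x v : V) dA dB :
  is_derive x v A dA -> is_derive x v B dB ->
  is_derive x v (fun q => dot (A q) (B q) : R^o) (dot dA (B x) + dot (A x) dB).
Proof.
move=> hA hB; have /is_derive_mxP/(_ ord0 ord0) := is_derive_mulmx (is_derive_trmx hA) hB.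
by rewrite mxE.
Qed.

(** The device for differentiating an identity that holds only near a point: compute the derivative
    of both sides and equate. *)
Lemma near_is_derive_eq (W : normedModType R) (f g : V -> W) (x v : V) df dg :
  (\forall q \near x, f q = g q) -> is_derive x v f df -> is_derive x v g dg ->
  df = dg.
Proof. by move=> fg [_ <-] [_ <-]; exact: near_eq_derive. Qed.

End MatrixDerivatives.

(** * Algebra of [Cn] maps on open sets *)

Section SmoothFunctions.
Variables (R : realType) (V : normedModType R).
Implicit Types (U : set V).

Lemma Cn_continuous (W : normedModType R) n U (f : V -> W) :
  Cn n U f -> forall x, U x -> {for x, continuous f}.
Proof. by case: n => [|n] []. Qed.

Lemma Cn_weaken (W : normedModType R) n U (f : V -> W) : Cn n.+1 U f -> Cn n U f.
Proof.
elim: n f => [|n IH] f [cf df]; split => // v.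
by have [dfv /IH] := df v.
Qed.

Lemma Cn_subset (W : normedModType R) n U U' (f : V -> W) :
  U' `<=` U -> Cn n U f -> Cn n U' f.
Proof.
move=> UU'; elim: n f => [|n IH] f [cf df]; split => //; try by move=> x /UU' /cf.
by move=> v; have [dfv /IH] := df v; split => // x /UU' /dfv.
Qed.

Lemma open_near_eq (T : Type) U (f g : V -> T) x : open U -> U x ->
  (forall q, U q -> f q = g q) -> \forall q \near x, f q = g q.
Proof. by move=> oU Ux fg; apply: filterS fg (open_nbhs_nbhs _). Qed.

Lemma near_eq_continuous (T : topologicalType) (f g : V -> T) x :
  (\forall q \near x, f q = g q) ->
  {for x, continuous f} -> {for x, continuous g}.
Proof.
move=> fg cf; rewrite /prop_for /continuous_at -(nbhs_singleton fg).
by apply: cvg_trans cf; exact: near_eq_cvg.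
Qed.

Lemma Cn_eq (W : normedModType R) n U (f g : V -> W) : open U ->
  (forall q, U q -> f q = g q) -> Cn n U f -> Cn n U g.
Proof.
move=> oU; elim: n f g => [|n IH] f g fg [cf df]; split.
- by move=> x Ux; apply: near_eq_continuous (open_near_eq oU Ux fg) (cf x Ux).
- by [].
- by move=> x Ux; apply: near_eq_continuous (open_near_eq oU Ux fg) (cf x Ux).
move=> v; have [dfv Cv] := df v; split.
  by move=> x Ux; apply: near_eq_derivable (open_near_eq oU Ux fg) (dfv x Ux).
apply: IH Cv => q Uq; apply: near_eq_derive; exact: open_near_eq Uq fg.
Qed.

Lemma Cn_cst (W : normedModType R) n U (w : W) : open U -> Cn n U (fun=> w).
Proof.
move=> oU; elim: n w => [|n IH] w; split => //; try by move=> x _; exact: cvg_cst.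
move=> v; split => [x _|]; first exact: derivable_cst.
by apply: (@Cn_eq _ _ _ (fun=> 0)) => // q _; rewrite derive_cst.
Qed.

Lemma CnD n U (f g : V -> R^o) : open U ->
  Cn n U f -> Cn n U g -> Cn n U (fun q => f q + g q : R^o).
Proof.
move=> oU; elim: n f g => [|n IH] f g [cf df] [cg dg]; split => //.
- by move=> x Ux; apply: cvgD; [exact: cf|exact: cg].
- by move=> x Ux; apply: cvgD; [exact: cf|exact: cg].
move=> v; have [dfv Cf] := df v; have [dgv Cg] := dg v; split.
  by move=> x Ux; apply: derivableD; [exact: dfv|exact: dgv].
apply: (Cn_eq _ _ (IH _ _ Cf Cg)) => // q Uq.
by rewrite -[RHS]/('D_v (f + g) q) deriveD//; [exact: dfv|exact: dgv].
Qed.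

Lemma CnM n U (f g : V -> R^o) : open U ->
  Cn n U f -> Cn n U g -> Cn n U (fun q => f q * g q : R^o).
Proof.
move=> oU; elim: n f g => [|n IH] f g Cf Cg.
  have [cf _] := Cf; have [cg _] := Cg; split => // x Ux.
  by apply: cvgM; [exact: cf|exact: cg].
have [cf df] := Cf; have [cg dg] := Cg; split.
  by move=> x Ux; apply: cvgM; [exact: cf|exact: cg].
move=> v; have [dfv Cfv] := df v; have [dgv Cgv] := dg v; split.
  by move=> x Ux; apply: (@derivableM _ _ f g); [exact: dfv|exact: dgv].
(* The Leibniz rule multiplies a derivative, regular to order [n], by an undifferentiated factor,
   regular to order [n.+1]; [Cn_weaken] brings the latter down to the induction hypothesis. *)
apply: (Cn_eq _ _ (CnD _ (IH _ _ (Cn_weaken Cf) Cgv) (IH _ _ (Cn_weaken Cg) Cfv))) => //.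
move=> q Uq; rewrite -[RHS]/('D_v ((f : V -> R) * (g : V -> R)) q).
by rewrite deriveM//; [exact: dfv|exact: dgv].
Qed.

Lemma Cn_sum (T : Type) (r : seq T) n U (f : T -> V -> R^o) : open U ->
  (forall k, Cn n U (f k)) -> Cn n U (fun q => \sum_(k <- r) f k q).
Proof.
move=> oU h; elim: r => [|k r IH].
  by apply: (@Cn_eq _ _ _ (fun=> 0)) (Cn_cst _ _ oU) => // q _; rewrite big_nil.
apply: (Cn_eq oU _ (CnD oU (h k) IH)) => q _; by rewrite big_cons.
Qed.

Lemma continuous_mxP m n (F : V -> 'M[R]_(m, n)) x :
  (forall i j, {for x, continuous (fun q => F q i j : R^o)}) ->
  {for x, continuous F}.
Proof.
move=> h; apply/cvgrPdist_le => e e0.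
have H (ij : 'I_m * 'I_n) :
    \forall q \near x, `|F x ij.1 ij.2 - F q ij.1 ij.2| <= e.
  by have /cvgrPdist_le/(_ e e0) := h ij.1 ij.2.
apply: (@filterS V (nbhs x) _ _ _ _ (@filter_forall V _ _ (nbhs x) _ H)) => q hq.
rewrite [leLHS]/Num.Def.normr/= mx_normrE (bigmax_le _ (ltW e0))//= => ij _.
by rewrite !mxE.
Qed.

Lemma coord_mx_continuous m n (F : V -> 'M[R]_(m, n)) i j x :
  {for x, continuous F} -> {for x, continuous (fun q => F q i j : R^o)}.
Proof.
move=> cF; apply: (@continuous_comp _ _ _ F (fun A : 'M[R]_(m, n) => A i j : R^o)) => //.
exact: (@coord_continuous R m n i j (F x)).
Qed.

Lemma Cn_mxP m n k U (F : V -> 'M[R]_(m, n)) : open U ->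
  Cn k U F <-> forall i j, Cn k U (fun q => F q i j : R^o).
Proof.
move=> oU; split.
  elim: k F => [|k IH] F [cF dF] i j.
    split => // x Ux; exact: coord_mx_continuous (cF x Ux).
  split.
    by move=> x Ux; exact: coord_mx_continuous (cF x Ux).
  move=> v; have [dFv /IH/(_ i j) Cv] := dF v; split.
    by move=> x Ux; apply: (derivable_mxP _ _ _).1; exact: dFv.
  by apply: Cn_eq Cv => // q Uq; rewrite derive_mx ?mxE//; exact: dFv.
elim: k F => [|k IH] F h; split => //.
- by move=> x Ux; apply: continuous_mxP => i j; exact: Cn_continuous (h i j) _ Ux.
- by move=> x Ux; apply: continuous_mxP => i j; exact: Cn_continuous (h i j) _ Ux.
move=> v; have dFv x : U x -> derivable F x v.
  by move=> Ux; apply/derivable_mxP => i j; have [_ /(_ v)[+ _]] := h i j; exact.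
split=> //; apply: IH => i j; have [_ /(_ v)[_]] := h i j.
by apply: Cn_eq => // q Uq; rewrite derive_mx ?mxE//; exact: dFv.
Qed.

End SmoothFunctions.

(** * Differentiation on the submanifold *)

Section RadialProjection.
Variable R : realType.
Local Notation V := (ambient R).

Lemma Cn_coord m n k (U : set 'M[R]_(m, n)) i j : open U ->
  Cn k U (fun q => q i j : R^o).
Proof.
move=> oU; have dc (q v : 'M[R]_(m, n)) :
    is_derive q v (fun q : 'M[R]_(m, n) => q i j : R^o) (v i j).
  by have /is_derive_mxP := is_derive_id q v; exact.
have cc (q : 'M[R]_(m, n)) : {for q, continuous (fun q : 'M[R]_(m, n) => q i j : R^o)}.
  exact: (@coord_continuous R m n i j q).
case: k => [|k]; split => // v; split => [q _|]; first by have [] := dc q v.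
apply: (Cn_eq oU _ (Cn_cst k (v i j : R^o) oU)) => q _.
by have [_ ->] := dc q v.
Qed.

Lemma differentiable_cV (W : normedModType R) n (f : W -> 'cV[R]_n) (x : W) :
  (forall i, differentiable (fun q => f q i ord0 : R^o) x) -> differentiable f x.
Proof.
move=> h; rewrite (_ : f = \sum_i (fun q => f q i ord0 *: (delta_mx i ord0 : 'cV[R]_n))).
  by apply: differentiable_sum => i; exact: differentiableZl.
by apply/funext => q; rewrite fct_sumE -cV_sum_delta.
Qed.

Lemma differentiable_dot (W : normedModType R) n (f : W -> 'cV[R]_n) (x : W) :
  (forall i, differentiable (fun q => f q i ord0 : R^o) x) ->
  differentiable (fun q => dot (f q) (f q) : R^o) x.
Proof.
move=> h; rewrite (_ : (fun _ => _) =
    \sum_i ((fun q => f q i ord0 : R) * (fun q => f q i ord0 : R))).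
  by apply: differentiable_sum => i; apply: differentiableM; exact: h.
by apply/funext => q; rewrite fct_sumE dotE.
Qed.

Lemma differentiable_invsqrt : differentiable (fun t : R => (Num.sqrt t)^-1 : R^o) (1 : R).
Proof.
apply: differentiableV; last by rewrite sqrtr1 oner_eq0.
apply/derivable1_diffP.
by have [] := @is_derive1_sqrt R 1 ltr01.
Qed.

(** The derivative of <f, f> along [v] is 2 <f, df> = 0, so the normalising factor is stationary.
    Used once for the sphere factor and once for the circle factor. *)
Lemma invnorm_derivative (W : normedModType R) n (f : W -> 'cV[R]_n) (x v : W)
    (df : 'cV[R]_n) :
  (forall i, differentiable (fun q => f q i ord0 : R^o) x) ->
  is_derive x v f df -> dot (f x) (f x) = 1 -> dot (f x) df = 0 ->
  let g := fun q => (Num.sqrt (dot (f q) (f q)))^-1 : R^o in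
  differentiable g x /\ is_derive x v g 0.
Proof.
move=> hf hdf f1 f0 g.
pose h q : R^o := dot (f q) (f q).
have dh : differentiable h x by exact: differentiable_dot.
have dk : differentiable (fun t : R => (Num.sqrt t)^-1 : R^o) (h x).
  rewrite /h f1; exact: differentiable_invsqrt.
have dg : differentiable g x.
  exact: (@differentiable_comp _ _ _ _ h (fun t : R => (Num.sqrt t)^-1 : R^o)).
split => //; split; first exact: diff_derivable.
rewrite deriveE// -[g]/((fun t : R => (Num.sqrt t)^-1 : R^o) \o h) diff_comp//=.
rewrite -[X in 'd _ _ X]deriveE//.
have [_ ->] := is_derive_dot hdf hdf.
by rewrite dotC f0 addr0 linear0.
Qed.

Lemma radial_proj_id (p : V) : M p -> radial_proj p = p.
Proof.
by move=> [h1 h2]; rewrite /radial_proj h1 h2 sqrtr1 invr1 !scale1r vsubmxK.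
Qed.

Lemma radial_proj_M (q : V) : 0 < dot (usubmx q) (usubmx q) ->
  0 < dot (dsubmx q) (dsubmx q) -> M (radial_proj q).
Proof.
move=> h1 h2; split; rewrite /radial_proj ?col_mxKu ?col_mxKd dotZl dotZr mulrA.
  by rewrite -invfM -expr2 sqr_sqrtr ?ltW// mulVf// gt_eqF.
by rewrite -invfM -expr2 sqr_sqrtr ?ltW// mulVf// gt_eqF.
Qed.

Lemma differentiable_usubmx_coord (p : V) i :
  differentiable (fun q : V => usubmx q i ord0 : R^o) p.
Proof.
rewrite (_ : (fun _ => _) = (fun q : V => q (lshift 2 i) ord0 : R^o)).
  exact: differentiable_coord.
by apply/funext => q; rewrite mxE.
Qed.

Lemma differentiable_dsubmx_coord (p : V) i :
  differentiable (fun q : V => dsubmx q i ord0 : R^o) p.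
Proof.
rewrite (_ : (fun _ => _) = (fun q : V => q (rshift 16 i) ord0 : R^o)).
  exact: differentiable_coord.
by apply/funext => q; rewrite mxE.
Qed.

Lemma M_near_radial_proj (p : V) : M p -> \forall q \near p, M (radial_proj q).
Proof.
move=> [p1 p2].
have near_pos (f : V -> R^o) : differentiable f p -> f p = 1 ->
    \forall q \near p, 0 < f q.
  move=> /differentiable_continuous cf f1.
  have : \forall y \near f p, (0 < y)%R by rewrite f1; exact: lt_nbhsr.
  by move/cf.
have h1 := near_pos _ (differentiable_dot (differentiable_usubmx_coord p)) p1.
have h2 := near_pos _ (differentiable_dot (differentiable_dsubmx_coord p)) p2.
by near=> q; apply: radial_proj_M; near: q.
Unshelve. all: by end_near. Qed.

(** Along tangent vectors both normalising factors are stationary and equal to 1, so the retraction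
    is the identity to first order. *)
Lemma is_derive_radial_proj (p v : V) : M p -> TM p v ->
  is_derive p v (@radial_proj R) v.
Proof.
move=> [p1 p2] [v1 v2].
have du := is_derive_usubmx (is_derive_id p v).
have dd := is_derive_dsubmx (is_derive_id p v).
have [_ n1] := invnorm_derivative (differentiable_usubmx_coord p) du p1 v1.
have [_ n2] := invnorm_derivative (differentiable_dsubmx_coord p) dd p2 v2.
have := is_derive_col_mx (is_derive_scalemx n1 du) (is_derive_scalemx n2 dd).
by rewrite p1 p2 sqrtr1 invr1 !scale0r !add0r !scale1r vsubmxK.
Qed.

Lemma differentiable_radial_proj (p : V) : M p -> differentiable (@radial_proj R) p.
Proof.
move=> [p1 p2].
(* The zero direction satisfies the orthogonality conditions of [invnorm_derivative] trivially; it
   serves to extract the differentiability of the normalising factors. *)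
have is_derive_0 := @is_derive_id R V p 0.
have du := is_derive_usubmx is_derive_0.
have dd := is_derive_dsubmx is_derive_0.
have z1 : dot (usubmx p) (usubmx (0 : V)) = 0 by rewrite linear0 dotC dot0l.
have z2 : dot (dsubmx p) (dsubmx (0 : V)) = 0 by rewrite linear0 dotC dot0l.
have [n1 _] := invnorm_derivative (differentiable_usubmx_coord p) du p1 z1.
have [n2 _] := invnorm_derivative (differentiable_dsubmx_coord p) dd p2 z2.
apply: differentiable_cV => i; case: (split_ordP i) => k ->.
  rewrite (_ : (fun _ => _) = (fun q : V => (Num.sqrt (dot (usubmx q) (usubmx q)))^-1)
      * (fun q : V => usubmx q k ord0)).
    apply: differentiableM; [exact: n1|exact: differentiable_usubmx_coord].
  by apply/funext => q; rewrite /radial_proj col_mxEu mxE.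
rewrite (_ : (fun _ => _) = (fun q : V => (Num.sqrt (dot (dsubmx q) (dsubmx q)))^-1)
      * (fun q : V => dsubmx q k ord0)).
  apply: differentiableM; [exact: n2|exact: differentiable_dsubmx_coord].
by apply/funext => q; rewrite /radial_proj col_mxEd mxE.
Qed.

Lemma C1_differentiable (F : V -> R^o) (U : set V) (p : V) : open U -> U p ->
  Cn 1 U F -> differentiable F p.
Proof.
move=> oU Up [_ dF]; apply: continuous_partials_differentiable => i.
  have [h _] := dF (delta_mx i ord0).
  by apply: filterS h (open_nbhs_nbhs _).
by have [_ [h _]] := dF (delta_mx i ord0); exact: h.
Qed.

Lemma C1_derive_linear (F : V -> R^o) (U : set V) (p : V) : open U -> U p ->
  Cn 1 U F -> forall (a : R) v w,
  'D_(a *: v + w) F p = a *: ('D_v F p : R^o) + 'D_w F p.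
Proof.
move=> oU Up /(C1_differentiable oU Up) dF a v w.
by rewrite !deriveE// linearP.
Qed.

Lemma near_radial_proj_eq (W : Type) (Y F : V -> W) (U : set V) (p : V) :
  M p -> open U -> U p -> (forall q, U q -> M q -> Y q = F q) ->
  \forall q \near p, Y (radial_proj q) = F (radial_proj q).
Proof.
move=> Mp oU Up YF.
have cr := differentiable_continuous (differentiable_radial_proj Mp).
have nU : \forall q \near p, U (radial_proj q).
  have : nbhs (radial_proj p) U by rewrite radial_proj_id//; apply: open_nbhs_nbhs.
  by move/cr.
have nM := M_near_radial_proj Mp.
near=> q; apply: YF; near: q => //.
Unshelve. all: by end_near. Qed.

(** Derivatives on M may be computed from any smooth extension: near [p], [Y] and [F] agree after
    the retraction, and the chain rule sees the identity on tangent vectors. *)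
Lemma is_derive_radial_ext (Y F : V -> R^o) (U : set V) (p v : V) : M p -> TM p v ->
  open U -> U p -> Cn 1 U F -> (forall q, U q -> M q -> Y q = F q) ->
  is_derive p v (Y \o @radial_proj R) ('D_v F p).
Proof.
move=> Mp Tv oU Up CF YF.
apply: (@near_eq_is_derive _ _ _ (F \o @radial_proj R)).
  by apply: filterS (near_radial_proj_eq Mp oU Up YF) => q /= ->.
have dF := C1_differentiable oU Up CF.
have dr := differentiable_radial_proj Mp.
have dF' : differentiable F (radial_proj p) by rewrite radial_proj_id.
have dFr : differentiable (F \o @radial_proj R) p by exact: differentiable_comp.
split; first exact: diff_derivable.
rewrite deriveE// diff_comp//= -(deriveE v dr).
have [_ ->] := is_derive_radial_proj Mp Tv.
by rewrite radial_proj_id// -deriveE.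
Qed.

Lemma is_derive_radial_ext_mx m n (Y F : V -> 'M[R]_(m, n)) (U : set V) (p v : V) :
  M p -> TM p v -> open U -> U p -> Cn 1 U F ->
  (forall q, U q -> M q -> Y q = F q) ->
  is_derive p v (Y \o @radial_proj R) ('D_v F p).
Proof.
move=> Mp Tv oU Up CF YF; apply/is_derive_mxP => i j.
have [_ /(_ v)[dF _]] := CF; rewrite derive_mx ?mxE; last exact: dF.
have := @is_derive_radial_ext (fun q => Y q i j) (fun q => F q i j) U p v Mp Tv oU Up.
apply; first exact: (Cn_mxP _ _ oU).1.
by move=> q Uq Mq; rewrite YF.
Qed.

Lemma C1_derive_linear_mx m n (F : V -> 'M[R]_(m, n)) (U : set V) (p : V) :
  open U -> U p -> Cn 1 U F -> forall (a : R) v w,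
  'D_(a *: v + w) F p = a *: 'D_v F p + 'D_w F p.
Proof.
move=> oU Up CF a v w; have [_ dF] := CF.
have dFv u : derivable F p u by have [h _] := dF u; exact: h.
apply/matrixP => i j; rewrite !derive_mx// !mxE.
by apply: (C1_derive_linear oU Up); exact: (Cn_mxP _ _ oU).1.
Qed.

(** [Cn] controls derivatives in constant directions; this rewrites differentiation along a varying
    field with smooth coefficients, as [lc_smooth] requires. *)
Lemma derive_sum_partials m n (F : V -> 'M[R]_(m, n)) (U : set V) (p : V) :
  open U -> U p -> Cn 1 U F -> forall v,
  'D_v F p = \sum_i v i ord0 *: 'D_(delta_mx i ord0) F p.
Proof.
move=> oU Up CF v.
have D0 : 'D_(0 : V) F p = 0 by rewrite derive0.
have lin := C1_derive_linear_mx oU Up CF.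
rewrite {1}(cV_sum_delta v).
elim/big_rec2: _ => [//|i y1 y2 _ e]; by rewrite lin e.
Qed.

Lemma smooth_at_is_derive m n (Y : V -> 'M[R]_(m, n)) (p v : V) : M p -> TM p v ->
  smooth_at p Y -> is_derive p v (Y \o @radial_proj R) (dM p v Y).
Proof.
move=> Mp Tv [F [U [oU Up CF YF]]].
have h := is_derive_radial_ext_mx Mp Tv oU Up (CF 1%N) YF.
by rewrite /dM; have [_ ->] := h.
Qed.

Lemma smooth_at_is_derive_scalar (f : V -> R^o) (p v : V) : M p -> TM p v ->
  smooth_at p f -> is_derive p v (f \o @radial_proj R) (dM p v f).
Proof.
move=> Mp Tv [F [U [oU Up CF YF]]].
have h := is_derive_radial_ext Mp Tv oU Up (CF 1%N) YF.
by rewrite /dM; have [_ ->] := h.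
Qed.

Lemma TM_linear (p : V) (a : R) (v w : V) : TM p v -> TM p w -> TM p (a *: v + w).
Proof.
move=> [v1 v2] [w1 w2]; split; rewrite !linearP dotDr dotZr.
  by rewrite v1 w1 mulr0 addr0.
by rewrite v2 w2 mulr0 addr0.
Qed.

Lemma dM_linear m n (Y : V -> 'M[R]_(m, n)) (p : V) (a : R) (v w : V) : M p ->
  TM p v -> TM p w -> smooth_at p Y ->
  dM p (a *: v + w) Y = a *: dM p v Y + dM p w Y.
Proof.
move=> Mp Tv Tw [F [U [oU Up CF YF]]].
have h u Tu := @is_derive_radial_ext_mx _ _ _ _ _ _ u Mp Tu oU Up (CF 1%N) YF.
rewrite /dM; have [_ ->] := h _ Tv; have [_ ->] := h _ Tw.
have [_ ->] := h _ (TM_linear a Tv Tw).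
exact: C1_derive_linear_mx oU Up (CF 1%N) _ _ _.
Qed.

End RadialProjection.

(** * The Levi-Civita connection *)

Section SmoothMatrices.
Variables (R : realType) (V : normedModType R) (U : set V).
Hypothesis oU : open U.

Lemma Cn_mulmx k m n p (A : V -> 'M[R]_(m, n)) (B : V -> 'M[R]_(n, p)) :
  Cn k U A -> Cn k U B -> Cn k U (fun q => A q *m B q).
Proof.
move=> /(Cn_mxP _ _ oU) hA /(Cn_mxP _ _ oU) hB; apply/(Cn_mxP _ _ oU) => i j.
apply: (Cn_eq oU _ (Cn_sum (index_enum 'I_n) oU (fun l => CnM oU (hA i l) (hB l j)))).
by move=> q _; rewrite mxE.
Qed.

Lemma Cn_trmx k m n (A : V -> 'M[R]_(m, n)) :
  Cn k U A -> Cn k U (fun q => (A q)^T).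
Proof.
move=> /(Cn_mxP _ _ oU) hA; apply/(Cn_mxP _ _ oU) => i j.
by apply: (Cn_eq oU _ (hA j i)) => q _; rewrite mxE.
Qed.

Lemma Cn_addmx k m n (A B : V -> 'M[R]_(m, n)) :
  Cn k U A -> Cn k U B -> Cn k U (fun q => A q + B q).
Proof.
move=> /(Cn_mxP _ _ oU) hA /(Cn_mxP _ _ oU) hB; apply/(Cn_mxP _ _ oU) => i j.
by apply: (Cn_eq oU _ (CnD oU (hA i j) (hB i j))) => q _; rewrite mxE.
Qed.

Lemma Cn_scalemx k m n (f : V -> R^o) (A : V -> 'M[R]_(m, n)) :
  Cn k U f -> Cn k U A -> Cn k U (fun q => f q *: A q).
Proof.
move=> hf /(Cn_mxP _ _ oU) hA; apply/(Cn_mxP _ _ oU) => i j.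
by apply: (Cn_eq oU _ (CnM oU hf (hA i j))) => q _; rewrite mxE.
Qed.

Lemma Cn_oppmx k m n (A : V -> 'M[R]_(m, n)) :
  Cn k U A -> Cn k U (fun q => - A q).
Proof.
move=> hA; apply: (Cn_eq oU _ (Cn_scalemx (Cn_cst k (-1 : R^o) oU) hA)) => q _.
by rewrite scaleN1r.
Qed.

Lemma Cn_usubmx k m1 m2 n (A : V -> 'M[R]_(m1 + m2, n)) :
  Cn k U A -> Cn k U (fun q => usubmx (A q)).
Proof.
move=> /(Cn_mxP _ _ oU) hA; apply/(Cn_mxP _ _ oU) => i j.
by apply: (Cn_eq oU _ (hA (lshift m2 i) j)) => q _; rewrite mxE.
Qed.

Lemma Cn_dsubmx k m1 m2 n (A : V -> 'M[R]_(m1 + m2, n)) :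
  Cn k U A -> Cn k U (fun q => dsubmx (A q)).
Proof.
move=> /(Cn_mxP _ _ oU) hA; apply/(Cn_mxP _ _ oU) => i j.
by apply: (Cn_eq oU _ (hA (rshift m1 i) j)) => q _; rewrite mxE.
Qed.

Lemma Cn_col_mx k m1 m2 n (A : V -> 'M[R]_(m1, n)) (B : V -> 'M[R]_(m2, n)) :
  Cn k U A -> Cn k U B -> Cn k U (fun q => col_mx (A q) (B q)).
Proof.
move=> /(Cn_mxP _ _ oU) hA /(Cn_mxP _ _ oU) hB; apply/(Cn_mxP _ _ oU) => i j.
case: (split_ordP i) => l ->.
  by apply: (Cn_eq oU _ (hA l j)) => q _; rewrite col_mxEu.
by apply: (Cn_eq oU _ (hB l j)) => q _; rewrite col_mxEd.
Qed.

Lemma Cn_dot k n (A B : V -> 'cV[R]_n) :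
  Cn k U A -> Cn k U B -> Cn k U (fun q => dot (A q) (B q) : R^o).
Proof.
move=> hA hB; exact: ((Cn_mxP _ _ oU).1 (Cn_mulmx (Cn_trmx hA) hB) ord0 ord0).
Qed.

Lemma Cn_summx (T : Type) (r : seq T) k m n (A : T -> V -> 'M[R]_(m, n)) :
  (forall t, Cn k U (A t)) -> Cn k U (fun q => \sum_(t <- r) A t q).
Proof.
move=> hA; apply/(Cn_mxP _ _ oU) => i j.
apply: (Cn_eq oU _ (Cn_sum r oU (fun t => (Cn_mxP _ _ oU).1 (hA t) i j))) => q _.
by rewrite summxE.
Qed.

End SmoothMatrices.

Section LeviCivita.
Variable R : realType.
Local Notation V := (ambient R).

Lemma Cn_id k (U : set V) : open U -> Cn k U (fun q => q).
Proof. by move=> oU; apply/(Cn_mxP _ _ oU) => i j; exact: Cn_coord. Qed.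

Definition tproj (p w : V) : V :=
  col_mx (usubmx w - dot (usubmx p) (usubmx w) *: usubmx p)
         (dsubmx w - dot (dsubmx p) (dsubmx w) *: dsubmx p).

Lemma tproj_TM (p w : V) : M p -> TM p (tproj p w).
Proof.
move=> [p1 p2]; rewrite /tproj; split.
  by rewrite col_mxKu dotDr dotNr dotZr p1 mulr1 subrr.
by rewrite col_mxKd dotDr dotNr dotZr p2 mulr1 subrr.
Qed.

Lemma tproj_id (p w : V) : TM p w -> tproj p w = w.
Proof. by move=> [w1 w2]; rewrite /tproj w1 w2 !scale0r !subr0 vsubmxK. Qed.

Lemma tproj_linear (p : V) (a : R) (v w : V) :
  tproj p (a *: v + w) = a *: tproj p v + tproj p w.
Proof.
rewrite /tproj scale_col_mx add_col_mx !linearP; congr col_mx.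
  rewrite dotDr dotZr scalerDl opprD addrACA; congr (_ + _).
  by rewrite scalerBr scalerA.
rewrite dotDr dotZr scalerDl opprD addrACA; congr (_ + _).
by rewrite scalerBr scalerA.
Qed.

Lemma tprojD (p v w : V) : tproj p (v + w) = tproj p v + tproj p w.
Proof. by have := tproj_linear p 1 v w; rewrite !scale1r. Qed.

Lemma tprojZ (p : V) (a : R) (v : V) : tproj p (a *: v) = a *: tproj p v.
Proof.
have t0 : tproj p 0 = 0.
  by have := tprojD p 0 0; rewrite addr0 => /esym/eqP; rewrite -subr_eq0 addrK => /eqP.
by have := tproj_linear p a v 0; rewrite t0 !addr0.
Qed.

Lemma tprojN (p v : V) : tproj p (- v) = - tproj p v.
Proof. by rewrite -scaleN1r tprojZ scaleN1r. Qed.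

Lemma dot_sub (v w : V) :
  dot v w = dot (usubmx v) (usubmx w) + dot (dsubmx v) (dsubmx w).
Proof.
rewrite !dotE big_split_ord; congr (_ + _); apply: eq_bigr => i _; by rewrite !mxE.
Qed.

Lemma dot_tproj (p v w : V) : TM p w -> dot (tproj p v) w = dot v w.
Proof.
move=> [w1 w2]; rewrite !dot_sub /tproj col_mxKu col_mxKd !dotDl !dotNl !dotZl.
by rewrite w1 w2 !mulr0 !subr0.
Qed.

(** The tangential part of the flat ambient derivative, which is the Levi-Civita connection of any
    Riemannian submanifold of Euclidean space. *)
Definition lc_connection : connection_operator R :=
  fun p v Y => tproj p (dM p v Y).

(** Turns a property known at points of M near [p] into one valid on a full ambient neighbourhood,
    where derivatives are taken. *)
Lemma near_radial_proj (P : V -> Prop) (p : V) : M p ->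
  (\forall q \near p, M q -> P q) -> \forall q \near p, P (radial_proj q).
Proof.
move=> Mp nP.
have cr := differentiable_continuous (differentiable_radial_proj Mp).
have nP' : \forall q \near p, M (radial_proj q) -> P (radial_proj q).
  have : \forall y \near radial_proj p, M y -> P y by rewrite radial_proj_id.
  by move/cr.
have nM := M_near_radial_proj Mp.
near=> q; have h : M (radial_proj q) by near: q.
by move: h; near: q.
Unshelve. all: by end_near. Qed.

(** Differentiate the tangency relations <x, Y> = 0 and <z, Y> = 0. They determine the normal part
    of the derivative of [Y] by an expression symmetric in [v] and [Y p], the second fundamental
    form. *)
Lemma dM_tangent (p v : V) Y : M p -> TM p v -> vector_field_at p Y ->
  dot (usubmx v) (usubmx (Y p)) + dot (usubmx p) (usubmx (dM p v Y)) = 0 /\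
  dot (dsubmx v) (dsubmx (Y p)) + dot (dsubmx p) (dsubmx (dM p v Y)) = 0.
Proof.
move=> Mp Tv [sY tY].
have dY := smooth_at_is_derive Mp Tv sY.
have dr := is_derive_radial_proj Mp Tv.
have nT := near_radial_proj Mp tY.
have d0 : is_derive p v (cst 0 : V -> R^o) 0 by exact: is_derive_cst.
split.
  have := is_derive_dot (is_derive_usubmx dr) (is_derive_usubmx dY).
  rewrite /= radial_proj_id// => h.
  apply: near_is_derive_eq h d0; apply: filterS nT => q [+ _]; exact.
have := is_derive_dot (is_derive_dsubmx dr) (is_derive_dsubmx dY).
rewrite /= radial_proj_id// => h.
apply: near_is_derive_eq h d0; apply: filterS nT => q [_ +]; exact.
Qed.

Lemma cancel_common (a b c : R) : a + b = 0 -> a + c = 0 -> b - c = 0.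
Proof. lra. Qed.

(** By symmetry of the second fundamental form the normal parts of the two derivatives cancel. *)
Lemma dM_bracket_TM (p : V) X Y : M p -> vector_field_at p X ->
  vector_field_at p Y -> TM p (lie_bracket X Y p).
Proof.
move=> Mp vX vY.
have TX : TM p (X p) by have [_ /nbhs_singleton] := vX; exact.
have TY : TM p (Y p) by have [_ /nbhs_singleton] := vY; exact.
have [h1 h2] := dM_tangent Mp TX vY; have [k1 k2] := dM_tangent Mp TY vX.
rewrite /lie_bracket; split; rewrite linearB dotDr dotNr.
  by apply: cancel_common h1 _; rewrite (dotC (usubmx (X p))).
by apply: cancel_common h2 _; rewrite (dotC (dsubmx (X p))).
Qed.

Lemma Cn_tproj k (U : set V) (A : V -> V) : open U -> Cn k U A ->
  Cn k U (fun q => tproj q (A q)).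
Proof.
move=> oU hA; rewrite /tproj.
have hu := Cn_usubmx oU (Cn_id k oU); have hd := Cn_dsubmx oU (Cn_id k oU).
have hAu := Cn_usubmx oU hA; have hAd := Cn_dsubmx oU hA.
apply: Cn_col_mx => //; apply: Cn_addmx => //; apply: Cn_oppmx => //.
  exact: (Cn_scalemx oU (Cn_dot oU hu hAu) hu).
exact: (Cn_scalemx oU (Cn_dot oU hd hAd) hd).
Qed.

Lemma lc_smooth (p : V) X Y : M p -> vector_field_at p X ->
  vector_field_at p Y -> smooth_at p (fun q => lc_connection q (X q) Y).
Proof.
move=> Mp [[FX [UX [oX Xp CX XF]]] tX] [[FY [UY [oY Yp CY YF]]] _].
(* The interior is included because [X] is tangent only near [p], while [dM] is computed by an
   extension only along tangent directions. *)
pose U := UX `&` UY `&` [set q | M q -> TM q (X q)]°.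
have oU : open U.
  by apply: openI; [exact: openI|exact: open_interior].
exists (fun q => tproj q (\sum_i FX q i ord0 *: 'D_(delta_mx i ord0) FY q)), U.
split => //.
- move=> n; apply: Cn_tproj => //; apply: Cn_summx => // i.
  apply: Cn_scalemx => //.
    have h : Cn n U FX by apply: Cn_subset (CX n) => q [[]].
    exact: ((Cn_mxP _ _ oU).1 h i ord0).
  have [_ /(_ (delta_mx i ord0))[_ h]] := CY n.+1.
  by apply: Cn_subset h => q [[]].
move=> q [[UXq UYq] Tq] Mq.
have TXq : TM q (X q) by move: (interior_subset Tq); exact.
rewrite /lc_connection; congr tproj.
have [_] := is_derive_radial_ext_mx Mq TXq oY UYq (CY 1%N) YF.
by rewrite /dM => ->; rewrite (derive_sum_partials oY UYq (CY 1%N)) XF.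
Qed.

Lemma lc_affine : affine_connection lc_connection.
Proof.
split.
- by move=> p v Y Mp _ _; exact: tproj_TM.
- move=> p a v w Y Mp Tv Tw [sY _].
  by rewrite /lc_connection (dM_linear a Mp Tv Tw sY) tproj_linear.
- move=> p v Y Y' Mp Tv [sY _] [sY' _].
  rewrite /lc_connection -tprojD; congr tproj.
  have := is_deriveD (smooth_at_is_derive Mp Tv sY) (smooth_at_is_derive Mp Tv sY').
  by move=> [_ <-].
- move=> p v f Y Mp Tv sf [sY tY].
  have TY : TM p (Y p) by move: tY => /nbhs_singleton; exact.
  have [_] := is_derive_scalemx (smooth_at_is_derive_scalar Mp Tv sf)
     (smooth_at_is_derive Mp Tv sY).
  rewrite /= radial_proj_id// => h.
  have e : dM p v (fun q => f q *: Y q) = dM p v f *: Y p + f p *: dM p v Y by exact: h.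
  by rewrite /lc_connection e tprojD !tprojZ (tproj_id TY).
- exact: lc_smooth.
Qed.

Lemma lc_metric : metric_connection lc_connection.
Proof.
move=> p v Y Z Mp Tv [sY tY] [sZ tZ].
have TY : TM p (Y p) by move: tY => /nbhs_singleton; exact.
have TZ : TM p (Z p) by move: tZ => /nbhs_singleton; exact.
have [_] := is_derive_dot (smooth_at_is_derive Mp Tv sY) (smooth_at_is_derive Mp Tv sZ).
rewrite /= radial_proj_id// => h.
rewrite /lc_connection dot_tproj// (dotC (Y p)) dot_tproj// (dotC _ (Y p)).
exact: h.
Qed.

Lemma lc_torsion_free : torsion_free lc_connection.
Proof.
move=> p X Y Mp vX vY.
rewrite -[RHS](tproj_id (dM_bracket_TM Mp vX vY)) /lie_bracket tprojD.
by rewrite tprojN.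
Qed.

Lemma lc_levi_civita : levi_civita lc_connection.
Proof. by split; [exact: lc_affine|exact: lc_metric|exact: lc_torsion_free]. Qed.

End LeviCivita.

(** * The homogeneous structure *)

Section StandardStructure.
Variables (R : realType) (I : 'I_9 -> 'M[R]_16).
Hypothesis hI : clifford9 I.
Local Notation V := (ambient R).

Definition rot90 : 'M[R]_2 :=
  \matrix_(i, j) if (i == 0) && (j == 1) then -1 else if (i == 1) && (j == 0) then 1 else 0.

Lemma matrix2P (A B : 'M[R]_2) : A 0 0 = B 0 0 -> A 0 1 = B 0 1 ->
  A 1 0 = B 1 0 -> A 1 1 = B 1 1 -> A = B.
Proof.
move=> h00 h01 h10 h11; apply/matrixP => i j.
have ord2 (k : 'I_2) : k = 0 \/ k = 1.
  by case: k => [[|[|//]] k]; [left|right]; apply: val_inj.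
by case: (ord2 i) => ->; case: (ord2 j) => ->.
Qed.

Lemma sum2 (F : 'I_2 -> R) : \sum_i F i = F 0 + F 1.
Proof. by rewrite big_ord_recl big_ord_recl big_ord0 addr0; congr (F _ + F _); apply: val_inj. Qed.

Lemma det_mx22 (A : 'M[R]_2) : \det A = A 0 0 * A 1 1 - A 0 1 * A 1 0.
Proof.
rewrite (expand_det_row A 0) sum2 /cofactor !det_mx11 !mxE /=.
have -> : lift 0 0 = 1 :> 'I_2 by apply: val_inj.
have -> : lift 1 0 = 0 :> 'I_2 by apply: val_inj.
by rewrite expr0 expr1 mul1r mulN1r mulrN.
Qed.

Lemma det_row_mx2 (z w : 'cV[R]_2) :
  \det (row_mx z w : 'M[R]_2) = z 0 0 * w 1 0 - w 0 0 * z 1 0.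
Proof.
have e0 : 0 = lshift 1 0 :> 'I_(1 + 1) by apply: val_inj.
have e1 : 1 = rshift 1 0 :> 'I_(1 + 1) by apply: val_inj.
have h0 i : row_mx z w i 0 = z i 0.
  exact: etrans (congr1 (row_mx z w i) e0) (row_mxEl _ _ _ _).
have h1 i : row_mx z w i 1 = w i 0.
  exact: etrans (congr1 (row_mx z w i) e1) (row_mxEr _ _ _ _).
by rewrite det_mx22 !h0 !h1.
Qed.

Lemma trmx_rot90 : rot90^T = - rot90.
Proof. by apply: matrix2P; rewrite !mxE /= ?oppr0 ?opprK. Qed.

Lemma rot90_sqr : rot90 *m rot90 = - 1%:M.
Proof. by apply: matrix2P; rewrite !mxE sum2 !mxE /=; ring. Qed.

Lemma rot90_orthogonal : rot90^T *m rot90 = 1%:M.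
Proof. by rewrite trmx_rot90 mulNmx rot90_sqr opprK. Qed.

Lemma dot_rot90 (z : 'cV[R]_2) : dot z (rot90 *m z) = 0.
Proof. by rewrite dotE sum2 !mxE !sum2 !mxE /=; ring. Qed.

Lemma dot_rot90_rot90 (z w : 'cV[R]_2) : dot (rot90 *m z) (rot90 *m w) = dot z w.
Proof. by rewrite dot_mulmxl mulmxA rot90_orthogonal mul1mx. Qed.

(** In dimension 2, r^T J r = det(r) J for every matrix r and the quarter turn J; here the
    determinant is 1. *)
Lemma SO2_rot90 (r : 'M[R]_2) : SO2 r -> r *m rot90 = rot90 *m r.
Proof.
move=> [rr rd].
have key : r^T *m rot90 *m r = rot90.
  have := rd; rewrite det_mx22 => {}rd.
  by apply: matrix2P; rewrite !(mxE, sum2) /= ?(mxE, sum2) /=; move: rd; lra.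
by rewrite -[in LHS]key !mulmxA (mulmx1C rr) mul1mx.
Qed.

(** Polynomial in [p], hence smooth on all of R^18 and its own smooth extension off M. *)
Definition std_frame (p : V) : 'M[R]_(16 + 2, 16) :=
  col_mx (1%:M - usubmx p *m (usubmx p)^T)
         (- (rot90 *m dsubmx p) *m (usubmx p)^T).

Definition std_structure (p : V) : set 'M[R]_(16 + 2, 16) :=
  [set e | exists2 g, Spin9 I g & e = std_frame p *m g].

(** On M the frame sends [x] to (0, - J z), so the field is tangent to the circle factor and has
    constant length 1/48. *)
Definition std_field (p : V) : V := 48^-1 *: (std_frame p *m usubmx p).

Lemma TM_std_frame (p : V) w : M p -> TM p (std_frame p *m w).
Proof.
move=> [p1 p2]; rewrite /std_frame mul_col_mx; split; rewrite /dot.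
  rewrite col_mxKu mulmxA mulmxBr mulmx1 mulmxA mulmx_dot p1 mul1mx subrr.
  by rewrite mul0mx mxE.
rewrite col_mxKd !mulNmx mulmxN -(mulmxA _ _ w) (mulmxA (dsubmx p)^T).
by rewrite mulmx_dot dot_rot90 raddf0 mul0mx oppr0 mxE.
Qed.

Lemma std_frame_orthogonal (p : V) : M p -> (std_frame p)^T *m std_frame p = 1%:M.
Proof.
move=> [p1 p2]; rewrite /std_frame tr_col_mx mul_row_col.
set x := usubmx p; set y := rot90 *m dsubmx p.
have y1 : y^T *m y = 1%:M by rewrite mulmx_dot dot_rot90_rot90 p2.
have x1 : x^T *m x = 1%:M by rewrite mulmx_dot p1.
have -> : (1%:M - x *m x^T)^T = 1%:M - x *m x^T.
  by rewrite [LHS]raddfB /= trmx1 trmx_mul trmxK.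
have -> : (- y *m x^T)^T = - (x *m y^T).
  by rewrite mulNmx [LHS]raddfN /= trmx_mul trmxK.
rewrite mulmxBr mulmx1 mulmxBl mul1mx -!mulmxA (mulmxA x^T) x1 mul1mx subrr subr0.
by rewrite !mulNmx mulmxN opprK -mulmxA (mulmxA y^T) y1 mul1mx subrK.
Qed.

Lemma std_frame_field (p : V) : M p ->
  (std_frame p)^T *m std_field p = 48^-1 *: usubmx p.
Proof. by move=> Mp; rewrite /std_field -scalemxAr mulmxA std_frame_orthogonal// mul1mx. Qed.

(** A column operation and a Schur complement reduce the determinant to that of the pair (z, J z),
    which is |z|^2. The minus sign in the circle block is what makes the second vector J z and not
    its opposite. *)
Lemma det_std_frame (p : V) : M p ->
  \det (row_mx (std_frame p) (row_mx (col_mx 0 (dsubmx p)) (col_mx (usubmx p) 0))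
    : 'M[R]_(16 + 2)) = 1.
Proof.
move=> [p1 p2]; set x := usubmx p; set z := dsubmx p.
pose B : 'M[R]_(16, 1 + 1) := row_mx 0 x.
pose D : 'M[R]_(2, 1 + 1) := row_mx z 0.
pose C : 'M[R]_(2, 16) := - (rot90 *m z) *m x^T.
pose E : 'M[R]_(1 + 1, 16) := col_mx 0 x^T.
have x1 : x^T *m x = 1%:M by rewrite mulmx_dot p1.
have -> : row_mx (std_frame p) (row_mx (col_mx 0 z) (col_mx x 0)) =
    block_mx (1%:M - x *m x^T) B C D :> 'M[R]_(16 + (1 + 1)).
  by rewrite /B /D /block_mx -block_mxEv block_mxEh; congr row_mx;
    rewrite -[LHS]block_mxEh block_mxEv.
set A := block_mx _ _ _ _.
(* Adding multiples of the column carrying the normal [x] restores the identity in place of the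
   projection [1 - x x^T]; that column has no circle component, so the lower block is untouched. *)
have hA : A *m block_mx 1%:M 0 E 1%:M = block_mx 1%:M B C D.
  rewrite mulmx_block !mulmx1 !mulmx0 !add0r /B /D /E !mul_row_col.
  by rewrite !(mul0mx, mulmx0, addr0, add0r) subrK.
have hA2 : block_mx 1%:M B C D = block_mx 1%:M 0 C 1%:M *m block_mx 1%:M B 0 (D - C *m B)
    :> 'M[R]_(16 + (1 + 1)).
  by rewrite mulmx_block !(mulmx1, mul1mx, mul0mx, mulmx0, addr0) (addrC (C *m B)) subrK.
have : \det (A *m block_mx 1%:M 0 E 1%:M) = \det A.
  by rewrite det_mulmx det_lblock !det1 !mulr1.
rewrite hA hA2 det_mulmx det_lblock det_ublock !det1 !mul1r => <-.
have -> : D - C *m B = row_mx z (rot90 *m z).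
  rewrite /D /B mul_mx_row mulmx0 /C -mulmxA x1 mulmx1 opp_row_mx add_row_mx.
  by rewrite oppr0 addr0 add0r opprK.
move: p2; rewrite dotE sum2 -/z => p2.
by rewrite det_row_mx2 -p2 !mxE !sum2 !mxE /=; ring.
Qed.

Lemma colE_mul m n (A : 'M[R]_(m, n)) (B : 'M[R]_n) j : col j (A *m B) = A *m col j B.
Proof. by rewrite !colE mulmxA. Qed.

Lemma SO_std_structure (p : V) : M p -> std_structure p `<=` SO_frame p.
Proof.
move=> Mp e [g gS ->]; split.
- by move=> j; rewrite colE_mul; exact: TM_std_frame.
- rewrite trmx_mul -mulmxA (mulmxA _ _ g) std_frame_orthogonal// mul1mx.
  exact: Spin9_orthogonal gS.
set N := row_mx _ (col_mx _ 0).
have -> : row_mx (std_frame p *m g) N =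
    (row_mx (std_frame p) N : 'M[R]_(16 + 2)) *m block_mx g 0 0 1%:M.
  by rewrite mul_row_block !mulmx0 mulmx1 addr0 add0r.
by rewrite det_mulmx det_std_frame// det_ublock (det_Spin9 hI gS) det1 !mulr1.
Qed.

Lemma Cn_std_frame k (U : set V) : open U -> Cn k U std_frame.
Proof.
move=> oU; rewrite /std_frame.
have hu := Cn_usubmx oU (Cn_id k oU); have hd := Cn_dsubmx oU (Cn_id k oU).
have hut := Cn_trmx oU hu.
apply: Cn_col_mx => //.
  apply: Cn_addmx => //; first exact: Cn_cst.
  by apply: Cn_oppmx => //; exact: (Cn_mulmx oU hu hut).
apply: (Cn_mulmx oU _ hut); apply: Cn_oppmx => //.
exact: (Cn_mulmx oU (Cn_cst k _ oU) hd).
Qed.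

Lemma smooth_std_frame (p : V) : smooth_at p std_frame.
Proof.
exists std_frame, setT; split => //; first exact: openT.
by move=> n; apply: Cn_std_frame; exact: openT.
Qed.

Lemma spin9_std_structure : spin9_structure I std_structure.
Proof.
split.
- exact: SO_std_structure.
- move=> p e e' Mp [g gS ->]; split => [[h hS ->]|[h hS ->]].
    exists (g^T *m h); first exact/Spin9_mul/hS/Spin9_trmx.
    by rewrite -mulmxA (mulmxA g) (Spin9_orthogonalr hI gS) mul1mx.
  by exists (g *m h); [exact: Spin9_mul|rewrite mulmxA].
- move=> p Mp; exists std_frame; split; first exact: smooth_std_frame.
  by apply: (@filterE _ (nbhs p)) => q _; exists 1%:M; [exact: Spin9_1|rewrite mulmx1].
Qed.

(** At (g x, r z) the frame composed with [g] is diag(g, r) times the frame at (x, z): [g] preserves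
    the inner product and [r] commutes with [rot90]. *)
Lemma homogeneous_std_structure : homogeneous_structure I std_structure.
Proof.
move=> g r p e gS rS Mp [h hS ->]; exists (g *m h); first exact: Spin9_mul.
have -> : block_mx g 0 0 r *m p = col_mx (g *m usubmx p) (r *m dsubmx p).
  by rewrite -[in LHS](vsubmxK p) mul_block_col !mul0mx addr0 add0r.
rewrite /std_frame col_mxKu col_mxKd !mulmxA; congr (_ *m _).
rewrite mul_block_col !mul0mx addr0 add0r mul_col_mx trmx_mul.
congr col_mx.
  rewrite mulmxBr mulmxBl mulmx1 mul1mx -!mulmxA.
  by rewrite (Spin9_orthogonal hI gS) mulmx1.
rewrite mulNmx mulmxN !mulmxA -(SO2_rot90 rS) !mulNmx.
by rewrite -!mulmxA (Spin9_orthogonal hI gS) mulmx1.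
Qed.

Lemma vector_field_std_field (p : V) : M p -> vector_field_at p std_field.
Proof.
move=> Mp; split.
  exists std_field, setT; split => //; first exact: openT.
  move=> n; rewrite /std_field; have oT := @openT V.
  apply: (Cn_scalemx oT (Cn_cst n (48^-1 : R^o) oT)).
  exact: (Cn_mulmx oT (Cn_std_frame n oT) (Cn_usubmx oT (Cn_id n oT))).
apply: (@filterE _ (nbhs p)) => q Mq; rewrite /std_field scalemxAr; exact: TM_std_frame.
Qed.

Lemma std_field_neq0 : exists2 p : V, M p & std_field p != 0.
Proof.
have d1 n : dot (delta_mx (ord0 : 'I_n.+1) ord0 : 'cV[R]_n.+1) (delta_mx ord0 ord0) = 1.
  rewrite dotE (bigD1 ord0)//= mxE !eqxx mulr1 big1 ?addr0// => a /negbTE a0.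
  by rewrite mxE a0 mul0r.
pose p : V := col_mx (delta_mx ord0 ord0) (delta_mx ord0 ord0).
have Mp : M p by split; rewrite /p ?col_mxKu ?col_mxKd d1.
exists p => //; apply/eqP => G0.
have := std_frame_field Mp; rewrite G0 mulmx0 => /esym/eqP.
rewrite scaler_eq0 invr_eq0 pnatr_eq0 /= => /eqP x0.
by have [] := Mp; rewrite x0 dot0l => /esym/eqP; rewrite oner_eq0.
Qed.

End StandardStructure.

(** * Near parallelism *)

Section NearlyParallel.
Variables (R : realType) (I : 'I_9 -> 'M[R]_16).
Hypothesis hI : clifford9 I.
Local Notation V := (ambient R).
Local Notation word := (word I).

Lemma triple_wordsP w : w \in triple_words -> exists a b c : 'I_9,
  [/\ (a < b)%N, (b < c)%N & w = [:: val a; val b; val c]].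
Proof.
move=> /allpairsPdep[a [bc [a9 /allpairsPdep[b [c []]] + + -> ->]]].
rewrite !mem_filter => /andP[ab b9] /andP[bc' c9].
move: a9 b9 c9; rewrite !mem_iota /= => a9 b9 c9.
by exists (Ordinal a9), (Ordinal b9), (Ordinal c9).
Qed.

Lemma triple_commute (a b c d : 'I_9) : d \notin [:: a; b; c] ->
  I a *m I b *m I c *m I d = - (I d *m (I a *m I b *m I c)).
Proof.
have [_ _ hC] := hI; rewrite !inE !negb_or => /and3P[da db dc].
have hd x : d != x -> I x *m I d = - (I d *m I x) by rewrite eq_sym; exact: hC.
have -> : I a *m I b *m I c *m I d = I a *m (I b *m (I c *m I d)).
  by rewrite !mulmxA.
rewrite (hd c dc) mulmxN (mulmxA (I b)) (hd b db) mulNmx opprK -(mulmxA (I d)).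
by rewrite (mulmxA (I a)) (hd a da) mulNmx !mulmxA.
Qed.

(* The conjugation by N q preserves R^9, so the conjugate of I_d is orthogonal
   to I_a I_b I_c I_d; the derivative of this relation isolates the coefficient
   of I_a I_b I_c in B. *)
Lemma derive_Spin9_curve (W : normedModType R) (N : W -> 'M[R]_16) (p v : W) B :
  (\forall q \near p, Spin9 I (N q)) -> N p = 1%:M -> is_derive p v N B ->
  B^T = - B /\ forall w, w \in triple_words -> \tr ((word w)^T *m B) = 0.
Proof.
move=> NS N1 dN.
have BT : B^T = - B.
  have := is_derive_mulmx (is_derive_trmx dN) dN.
  rewrite N1 mulmx1 trmx1 mul1mx => h.
  apply/eqP; rewrite -addr_eq0; apply/eqP.
  apply: (near_is_derive_eq _ h (is_derive_cst (1%:M : 'M[R]_16) p v)).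
  by apply: filterS NS => q /= /(Spin9_orthogonal hI).
split => // w wt; have [hS hT _] := hI.
have [a [b [c [ab bc we]]]] := triple_wordsP wt.
have [d dabc] : exists d : 'I_9, d \notin [:: a; b; c].
  apply/existsP; rewrite -negb_forall; apply/negP => /forallP all_abc.
  have : {subset enum 'I_9 <= [:: a; b; c]} by move=> d _; exact: all_abc.
  by move/(uniq_leq_size (enum_uniq _)); rewrite size_enum_ord.
pose K := I a *m I b *m I c *m I d.
have cst0 (A : 'M[R]_16) : is_derive p v (fun=> A : 'M[R]_16) 0.
  exact: is_derive_cst.
have := is_derive_mxtrace (is_derive_mulmx (is_derive_mulmx
  (is_derive_mulmx dN (cst0 (I d))) (is_derive_trmx dN)) (cst0 K)).
rewrite N1 trmx1 !mulmx0 !addr0 !mulmx1 !mul1mx BT => h.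
have {h} trK : \tr ((B *m I d + I d *m - B) *m K) = 0.
  have d0 : is_derive p v (cst 0 : W -> R^o) 0 by exact: is_derive_cst.
  apply: near_is_derive_eq h d0; apply: filterS NS => q qS.
  by rewrite (Spin9_tr4 hI qS ab bc dabc).
have wordE : word w = I a *m I b *m I c by rewrite we word_triple.
have e1 : B *m I d *m K = - (B *m word w).
  by rewrite -mulmxA /K triple_commute// !mulmxN (mulmxA (I d) (I d)) hS mul1mx wordE.
have e2 : \tr (I d *m B *m K) = \tr (B *m word w).
  rewrite -mulmxA mxtrace_mulC /K -!mulmxA hS mulmx1 wordE.
  by rewrite -!mulmxA.
move: trK; rewrite mulmxDl mulmxN mulNmx mxtraceD e1.
rewrite !raddfN /= e2 => trK.
rewrite trmx_skew_word ?triple_word_skew// mulNmx raddfN /= mxtrace_mulC.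
by move: trK; move: (\tr _) => t; lra.
Qed.

(** Pairing with the tangent columns of the frame makes the projection in [lc_connection]
    invisible. *)
Lemma connection_form_lc (s : V -> 'M[R]_(16 + 2, 16)) (p v : V) : M p ->
  TM p v -> smooth_at p s -> (forall j, TM p (col j (s p))) ->
  connection_form (@lc_connection R) s p v = (s p)^T *m dM p v s.
Proof.
move=> Mp Tv ss Ts; apply/matrixP => i j; rewrite !mxE.
have [_] := is_derive_col j (smooth_at_is_derive Mp Tv ss).
rewrite /lc_connection dotC dot_tproj// dotC => e.
have -> : dM p v (fun q => col j (s q)) = col j (dM p v s) by exact: e.
by rewrite dotE; apply: eq_bigr => k _; rewrite !mxE.
Qed.

(** With [u] the sphere component of [v], the sphere block contributes [- u x^T] and the circle
    block contributes [x u^T]. The remaining terms vanish, by the tangency of [v] or because the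
    projection [1 - x x^T] kills [x]. *)
Lemma derive_std_frame (p v : V) : M p -> TM p v ->
  exists2 D, is_derive p v (@std_frame R \o @radial_proj R) D &
    (std_frame p)^T *m D =
      usubmx p *m (usubmx v)^T - usubmx v *m (usubmx p)^T.
Proof.
move=> Mp Tv; have [p1 p2] := Mp; have [v1 v2] := Tv.
have dr := is_derive_radial_proj Mp Tv.
have du := is_derive_usubmx dr; have dd := is_derive_dsubmx dr.
have cst0 m n (A : 'M[R]_(m, n)) : is_derive p v (fun=> A : 'M[R]_(m, n)) 0.
  exact: is_derive_cst.
have dA := is_deriveB (cst0 _ _ 1%:M) (is_derive_mulmx du (is_derive_trmx du)).
have dB := is_derive_mulmx (is_deriveN (is_derive_mulmx (cst0 _ _ (@rot90 R)) dd))
  (is_derive_trmx du).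
have dF := is_derive_col_mx dA dB; eexists; first exact: dF.
rewrite -[(- (fun _ => _)) p]/(- (rot90 R *m dsubmx (radial_proj p))).
rewrite radial_proj_id// /std_frame tr_col_mx mul_row_col mul0mx !add0r.
set x := usubmx p; set y := rot90 R *m dsubmx p.
set ux := usubmx v; set yx := rot90 R *m dsubmx v.
have x1 : x^T *m x = 1%:M by rewrite mulmx_dot p1.
have y1 : y^T *m y = 1%:M by rewrite mulmx_dot dot_rot90_rot90 p2.
have xu : x^T *m ux = 0 by rewrite mulmx_dot v1 raddf0.
have yy : y^T *m yx = 0 by rewrite mulmx_dot dot_rot90_rot90 v2 raddf0.
clearbody y yx.
have -> : (1%:M - x *m x^T)^T = 1%:M - x *m x^T.
  by rewrite [LHS]raddfB /= trmx1 trmx_mul trmxK.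
have -> : (- y *m x^T)^T = - (x *m y^T).
  by rewrite mulNmx [LHS]raddfN /= trmx_mul trmxK.
rewrite mulmxN mulmxDr !mulmxBl !mul1mx -!mulmxA.
rewrite (mulmxA x^T ux) xu mul0mx mulmx0 subr0 (mulmxA x^T x) x1 mul1mx subrr addr0.
rewrite !mulNmx mulmxDr !mulmxN opprD !opprK -!mulmxA.
rewrite (mulmxA y^T yx) yy mul0mx mulmx0 (mulmxA y^T y) y1 mul1mx add0r.
by rewrite addrC.
Qed.

Lemma frame_endM (e : 'M[R]_(16 + 2, 16)) A B : e^T *m e = 1%:M ->
  frame_end e A *m frame_end e B = frame_end e (A *m B).
Proof.
move=> ee; rewrite /frame_end !mulmxA; congr (_ *m _ *m _).
by rewrite -!mulmxA ee mulmx1.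
Qed.

Lemma frame_endZ (e : 'M[R]_(16 + 2, 16)) k A :
  frame_end e (k *: A) = k *: frame_end e A.
Proof. by rewrite /frame_end -scalemxAr -scalemxAl. Qed.

Lemma frame_end_sum (e : 'M[R]_(16 + 2, 16)) (T : finType) (P : pred T)
    (A : T -> 'M[R]_16) :
  frame_end e (\sum_(t | P t) A t) = \sum_(t | P t) frame_end e (A t).
Proof. by rewrite /frame_end mulmx_sumr mulmx_suml. Qed.

Lemma tr_outer n (A : 'M[R]_n) (x w : 'cV[R]_n) :
  \tr (A *m (x *m w^T)) = dot w (A *m x).
Proof. by rewrite mulmxA mxtrace_mulC mulmx_dot mxtrace_scalar mulr1n. Qed.

Lemma std_structure_nearly_parallel :
  nearly_parallel I (@lc_connection R) (std_structure I) (@std_field R).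
Proof.
split; first by move=> p; exact: vector_field_std_field.
move=> p s X Mp [ss sQ] TX.
have [h hS sp] : std_structure I p (s p) by move: sQ => /nbhs_singleton; exact.
have ee : (s p)^T *m s p = 1%:M.
  by have [_ ->] := SO_std_structure hI Mp (ex_intro2 _ _ h hS sp).
have Ts j : TM p (col j (s p)).
  by have [+ _ _] := SO_std_structure hI Mp (ex_intro2 _ _ h hS sp); exact.
rewrite (connection_form_lc Mp TX ss Ts).
have [D dD FD] := derive_std_frame Mp TX.
have dS := smooth_at_is_derive Mp TX ss.
have nearQ := near_radial_proj Mp sQ.
have nearM := M_near_radial_proj Mp.
have FF := std_frame_orthogonal Mp.
have hh := Spin9_orthogonal hI hS.
(* The transition map from the global frame to [s]. Defined by this product it is visibly
   differentiable, and near [p] it takes values in [Spin9]. *)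
pose H q := (std_frame (radial_proj q))^T *m s (radial_proj q).
have dH := is_derive_mulmx (is_derive_trmx dD) dS.
move: dH; set DH := (X in is_derive _ _ _ X) => dH.
have nearH : \forall q \near p, Spin9 I (H q) /\
    s (radial_proj q) = std_frame (radial_proj q) *m H q.
  near=> q.
  have Mq : M (radial_proj q) by near: q.
  have [g gS sq] : std_structure I (radial_proj q) (s (radial_proj q)) by near: q.
  have Hg : H q = g by rewrite /H sq mulmxA std_frame_orthogonal// mul1mx.
  by rewrite Hg.
have Hp : H p = h by rewrite /H radial_proj_id// sp mulmxA FF mul1mx.
pose B := h^T *m DH.
have [BT trB] : B^T = - B /\ forall w, w \in triple_words -> \tr ((word w)^T *m B) = 0.
  (* Left translation by [h^T] keeps the map in [Spin9] and makes it pass through the identity at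
     [p]. *)
  apply: (@derive_Spin9_curve V (fun q => h^T *m H q) p X).
  - by apply: filterS nearH => q [qS _]; apply: Spin9_mul qS; exact: Spin9_trmx.
  - by rewrite Hp.
  have := is_derive_mulmx (is_derive_cst h^T p X) dH.
  by rewrite mul0mx add0r.
have DS : dM p X s = D *m h + std_frame p *m DH.
  have := is_derive_mulmx dD dH; rewrite /= -/(H p) Hp radial_proj_id// => h1.
  apply: near_is_derive_eq dS h1.
  by apply: filterS nearH => q [_].
set x := h^T *m usubmx p; set w := h^T *m usubmx X.
set Z := (s p)^T *m _.
(* The gauge transformation rule: the form of the global frame conjugated by [h], which rotates [x]
   and [w], plus the term [B] that has no component in m. *)
have ZE : Z = x *m w^T - w *m x^T + B.
  rewrite /Z DS sp trmx_mul mulmxDr -!mulmxA (mulmxA _ _ h) FD.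
  rewrite (mulmxA _ (std_frame p)) FF mul1mx -/B; congr (_ + _).
  by rewrite mulmxBl mulmxBr /x /w !trmx_mul !trmxK !mulmxA.
have ZT : Z^T = - Z.
  rewrite ZE [LHS]raddfD /= BT opprD; congr (_ + _).
  by rewrite [LHS]raddfB /= !trmx_mul !trmxK opprB.
have Wskew (W : 'M[R]_16) : W^T = - W -> \tr (W *m Z) = \tr (W *m B) + 2 * dot (W *m x) w.
  move=> WT; rewrite ZE mulmxDr mxtraceD addrC; congr (_ + _).
  rewrite mulmxBr raddfB /= !tr_outer (dotC w) -[W in dot x (W *m _)]trmxK.
  by rewrite -dot_mulmxl WT mulNmx dotNl; ring.
(* Coordinates of [X] in the frame: the sphere component gives [w] and the circle component a
   multiple of [x], to be discarded below. *)
have eX : (s p)^T *m X = w - dot (rot90 R *m dsubmx p) (dsubmx X) *: x.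
  rewrite sp trmx_mul -mulmxA -{1}(vsubmxK X) /std_frame tr_col_mx mul_row_col.
  have [X1 X2] := TX.
  rewrite [(1%:M - _)^T]raddfB /= trmx1 trmx_mul trmxK mulmxBl mul1mx.
  rewrite -mulmxA mulmx_dot X1 raddf0 mulmx0 subr0.
  rewrite mulNmx [(- _)^T]raddfN /= trmx_mul trmxK mulNmx -mulmxA mulmx_dot.
  by rewrite mul_mx_scalar mulmxBr -scalemxAr.
have eG : (s p)^T *m std_field p = 48^-1 *: x.
  by rewrite sp trmx_mul -mulmxA std_frame_field// -scalemxAr.
rewrite (m_part_skew hI ZT) sum_triple_words /vector_form /=.
rewrite frame_endZ !frame_end_sum !scaler_sumr; apply: eq_bigr => a _.
rewrite !frame_end_sum !scaler_sumr; apply: eq_bigr => b ab.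
rewrite !frame_end_sum !scaler_sumr; apply: eq_bigr => c bc.
have wt := mem_triple_words ab bc.
rewrite frame_endZ !frame_endM// !scalerA.
have Wsk : ((word [:: val a; val b; val c])^T)^T = - (word [:: val a; val b; val c])^T.
  by rewrite trmx_skew_word ?triple_word_skew// raddfN /= trmx_skew_word ?triple_word_skew.
have [_ hT _] := hI.
have WT : (word [:: val a; val b; val c])^T = I c *m I b *m I a.
  by rewrite word_triple !trmx_mul !hT mulmxA.
rewrite (Wskew _ Wsk) (trB _ wt); rewrite WT in Wsk *; rewrite word_triple.
congr (_ *: _).
set K := I c *m I b *m I a in Wsk *; clearbody K.
rewrite /frame_end -!mulmxA eG (dot_mulmxl (s p)) eX -scalemxAr dotZl dotDr dotNr dotZr.
(* Skewness of [K] removes the circle component of [X], in accordance with the connection form,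
   which depends only on its sphere component. *)
have -> : dot (K *m x) x = 0.
  have : dot (K *m x) x = - dot (K *m x) x.
    by rewrite {1}dot_mulmxl Wsk mulNmx dotNr dotC.
  by move: (dot _ _) => t; lra.
(* The constants meet here: 2/16 from the trace form against 6/48 from the vector form. *)
by rewrite mulr0 subr0 add0r; field.
Unshelve. all: by end_near. Qed.

End NearlyParallel.

Theorem mainTheorem3 (R : realType) (I : 'I_9 -> 'M[R]_16)
    (hI : clifford9 I) :
  sphere_eq_quotient I /\
  exists (nabla : connection_operator R)
         (Q : ambient R -> set 'M[R]_(16 + 2, 16))
         (G : ambient R -> ambient R),
    [/\ levi_civita nabla,
        spin9_structure I Q,
        homogeneous_structure I Q,
        nearly_parallel I nabla Q G
      & exists2 p, M p & G p != 0].
Proof.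
split; first exact: sphere_eq_quotient_spin9.
exists (@lc_connection R), (std_structure I), (@std_field R); split.
- exact: lc_levi_civita.
- exact: spin9_std_structure.
- exact: homogeneous_std_structure.
- exact: std_structure_nearly_parallel.
- exact: std_field_neq0.
Qed.
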